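(* Let $n\geq 1$. The assignment $u_i\mapsto \mathfrak{u}_i$ ($0\le i\le n-1$) extends to a monoid isomorphism $\phi: Bl_n\to \mathfrak{Bl}_n$ from the blob monoid onto the diagrammatic blob monoid.
   Context: The blob monoid $Bl_n$ is the monoid presented by generators $u_0,u_1,\dots,u_{n-1}$ and relations: $u_i^2=u_i$ for all $i$; $u_iu_j=u_ju_i$ for $|i-j|>1$; $u_1u_0u_1=u_1$; $u_iu_ju_i=u_i$ for $|i-j|=1$ with $i,j\neq 0$. A TL-diagram on $n$ points: place top points $1,\dots,n$ at $(1,1),\dots,(n,1)$ and bottom points $1',\dots,n'$ at $(1,0),\dots,(n,0)$ in the strip $\mathbb{R}\times[0,1]$; a TL-diagram is a set of $n$ pairwise disjoint arcs in the strip (interiors in the open strip) pairing up these $2n$ points, considered up to isotopy (equivalently, a non-crossing perfect matching of the $2n$ points). The complement of the arcs in the strip has one or two unbounded regions; the left side is the unbounded region containing the points $(x,1/2)$ with $x$ very negative. An arc is exposed to the left side if it lies in the boundary of the left side. A blobbed TL-diagram is a TL-diagram in which some of the arcs exposed to the left side carry a decoration called a blob, at most one blob per arc (only left-exposed arcs may carry blobs). The diagrammatic blob monoid $\mathfrak{Bl}_n$ is the set of blobbed TL-diagrams on $n$ points with the product $D\cdot D'$ obtained by placing $D$ above $D'$ (identifying the bottom points of $D$ with the top points of $D'$), deleting all closed loops (with or without blobs), and giving each resulting arc exactly one blob if any of its constituent pieces carried a blob, and no blob otherwise. Its generators are: $\mathfrak{u}_0$ = the identity diagram (arcs $\{k,k'\}$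 for all $k$) with a blob on the arc $\{1,1'\}$; and for $1\le i\le n-1$, $\mathfrak{u}_i$ = the unblobbed diagram with arcs $\{i,i+1\}$, $\{i',(i+1)'\}$ and $\{k,k'\}$ for $k\notin\{i,i+1\}$. *)

(* Defs.v *)
From HB Require Import structures.
From mathcomp Require Import all_boot.
From mathcomp Require Import boolp zify.

Set Implicit Arguments.
Unset Strict Implicit.
Unset Printing Implicit Defensive.

Local Open Scope quotient_scope.

(* The congruence on words generated by R. *)
Inductive pres_eq (A : Type) (R : seq A -> seq A -> Prop) :
    seq A -> seq A -> Prop :=
| pres_refl w : pres_eq R w w
| pres_sym w1 w2 : pres_eq R w1 w2 -> pres_eq R w2 w1
| pres_trans w1 w2 w3 : pres_eq R w1 w2 -> pres_eq R w2 w3 -> pres_eq R w1 w3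
| pres_step p q w1 w2 : R w1 w2 -> pres_eq R (p ++ w1 ++ q) (p ++ w2 ++ q).

Section PresentedMonoid.
Variables (A : choiceType) (R : seq A -> seq A -> Prop).

Definition pres_eqb (w1 w2 : seq A) : bool := `[< pres_eq R w1 w2 >].

Lemma pres_eqb_equiv : equiv_class_of pres_eqb.
Proof.
split=> [w | w1 w2 | w2 w1 w3].
- exact/asboolP/pres_refl.
- by apply/asboolP/asboolP; apply: pres_sym.
- by move=> /asboolP h12 /asboolP h23; apply/asboolP/(pres_trans h12).
Qed.

Canonical pres_equiv := EquivRelPack pres_eqb_equiv.

Definition presented_monoid := {eq_quot pres_equiv}.
HB.instance Definition _ := Choice.on presented_monoid.
HB.instance Definition _ := EqQuotient.on presented_monoid.

Lemma pres_piP (w1 w2 : seq A) :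
  \pi_presented_monoid w1 = \pi_presented_monoid w2 <-> pres_eq R w1 w2.
Proof.
split=> [/eqmodP/asboolP //|h]; apply/eqmodP; exact/asboolP.
Qed.

Lemma pres_eq_cat v1 v2 w1 w2 :
  pres_eq R v1 v2 -> pres_eq R w1 w2 -> pres_eq R (v1 ++ w1) (v2 ++ w2).
Proof.
move=> hv hw; apply: (@pres_trans _ _ _ (v2 ++ w1)).
- elim: hv => [w|a b _|a b c _ h1 _ h2|p q a b r].
  + exact: pres_refl.
  + exact: pres_sym.
  + exact: pres_trans h1 h2.
  + by rewrite -!catA; apply: pres_step.
- elim: hw => [w|a b _|a b c _ h1 _ h2|p q a b r].
  + exact: pres_refl.
  + exact: pres_sym.
  + exact: pres_trans h1 h2.
  + by rewrite !(catA v2); apply: pres_step.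
Qed.

Definition pres_one : presented_monoid := \pi_presented_monoid [::].
Definition pres_mul (x y : presented_monoid) : presented_monoid :=
  \pi_presented_monoid (repr x ++ repr y).
Definition pres_gen (a : A) : presented_monoid := \pi_presented_monoid [:: a].

Lemma pres_pi_cat v w :
  \pi_presented_monoid (v ++ w)
  = pres_mul (\pi_presented_monoid v) (\pi_presented_monoid w).
Proof.
apply/pres_piP; apply: pres_eq_cat; apply/pres_piP; by rewrite reprK.
Qed.

Lemma pres_mulA : associative pres_mul.
Proof.
elim/quotW=> x; elim/quotW=> y; elim/quotW=> z.
by rewrite -(pres_pi_cat y z) -(pres_pi_cat x y)
           -(pres_pi_cat x (y ++ z)) -(pres_pi_cat (x ++ y) z) catA.
Qed.

Lemma pres_mul1x : left_id pres_one pres_mul.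
Proof. by elim/quotW=> x; rewrite -(pres_pi_cat [::] x). Qed.

Lemma pres_mulx1 : right_id pres_one pres_mul.
Proof. by elim/quotW=> x; rewrite -(pres_pi_cat x [::]) cats0. Qed.

HB.instance Definition _ :=
  isMonoid.Build presented_monoid pres_mulA pres_mul1x pres_mulx1.

End PresentedMonoid.

Inductive blob_rel (n : nat) : seq 'I_n -> seq 'I_n -> Prop :=
| blob_idem (i : 'I_n) : blob_rel [:: i; i] [:: i]
| blob_comm (i j : 'I_n) : (i.+1 < j) || (j.+1 < i) ->
    blob_rel [:: i; j] [:: j; i]
| blob_101 (i j : 'I_n) : i = 0 :> nat -> j = 1 :> nat ->
    blob_rel [:: j; i; j] [:: j]
| blob_tl (i j : 'I_n) : (i.+1 == j) || (j.+1 == i) ->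
    i != 0 :> nat -> j != 0 :> nat -> blob_rel [:: i; j; i] [:: i].

Definition blob_monoid (n : nat) := presented_monoid (@blob_rel n).
HB.instance Definition _ n := Monoid.on (blob_monoid n).

Definition blob_gen (n : nat) (i : 'I_n) : blob_monoid n :=
  pres_gen (@blob_rel n) i.

(* [inl i] is the top point number i+1 and [inr i] the bottom point (i+1)'. *)
Notation pt n := ('I_n + 'I_n)%type.

(* Rank of a boundary point when the boundary of the strip is followed from
   left infinity through 1, ..., n and then n', ..., 1' back to left infinity. *)
Definition pos (n : nat) (p : pt n) : nat :=
  match p with inl i => i | inr i => n + rev_ord i end.

Section Diagrams.
Variable n : nat.
Implicit Types (m : {ffun pt n -> pt n}) (B : {set pt n}).

(* A perfect matching is given by the map sending a point to the other
   endpoint of its arc. *)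
Definition perfect_matching m : bool :=
  [forall x, (m x != x) && (m (m x) == x)].

Definition noncrossing m : bool :=
  [forall x, forall y,
    ~~ [&& pos x < pos y, pos y < pos (m x) & pos (m x) < pos (m y)]].

(* The arc {y, m y} with pos y < pos (m y) cuts off from the left side exactly
   the points of rank strictly between; the arc through x is exposed to the
   left side when no arc separates it from the left side. *)
Definition left_exposed m (x : pt n) : bool :=
  [forall y, ~~ (pos y < pos x < pos (m y))].

(* B is the set of all endpoints of the arcs carrying a blob. *)
Definition is_blobbed_TL (D : {ffun pt n -> pt n} * {set pt n}) : bool :=
  [&& perfect_matching D.1, noncrossing D.1,
      [forall x in D.2, D.1 x \in D.2] & [forall x in D.2, left_exposed D.1 x]].

Record blobbed_TL := BlobbedTL {
  TL_val : {ffun pt n -> pt n} * {set pt n};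
  _ : is_blobbed_TL TL_val }.

HB.instance Definition _ := [isSub for TL_val].
HB.instance Definition _ := [Finite of blobbed_TL by <:].

Definition mate (D : blobbed_TL) : {ffun pt n -> pt n} := (TL_val D).1.
Definition blobs (D : blobbed_TL) : {set pt n} := (TL_val D).2.

End Diagrams.

(* The points of the picture of D above D': tops of D (inl (inl i)), the
   identified middle points (inl (inr i)), and bottoms of D' (inr i). *)
Notation stk n := (pt n + 'I_n)%type.

Definition upper (n : nat) (p : pt n) : stk n := inl p.
Definition lower (n : nat) (p : pt n) : stk n :=
  match p with inl i => inl (inr i) | inr i => inr i end.
Definition outer (n : nat) (p : pt n) : stk n :=
  match p with inl i => inl (inl i) | inr i => inr i end.

Definition arc_rel (S T : finType) (f : S -> T) (m : {ffun S -> S}) : rel T :=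
  [rel u v | [exists p, (u == f p) && (v == f (m p))]].

Section Product.
Variable n : nat.
Implicit Types (D E : blobbed_TL n).

(* u and v lie on the same curve of the picture of D above E. A closed loop has
   no outer point, so it leaves no trace in prod_mate and prod_blobs. *)
Definition stacked D E : rel (stk n) :=
  connect (relU (arc_rel (@upper n) (mate D)) (arc_rel (@lower n) (mate E))).

Definition prod_mate D E : {ffun pt n -> pt n} :=
  [ffun x => odflt x [pick y | (y != x) && stacked D E (outer x) (outer y)]].

Definition prod_blobs D E : {set pt n} :=
  [set x | [exists y in blobs D, stacked D E (outer x) (upper y)]
        || [exists y in blobs E, stacked D E (outer x) (lower y)]].

Definition id_mate : {ffun pt n -> pt n} :=
  [ffun x => match x with inl k => inr k | inr k => inl k end].

Definition ipred (i : 'I_n) : 'I_n :=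
  Ordinal (leq_ltn_trans (leq_pred i) (ltn_ord i)).

(* For i > 0: since indices start from 0, the points number i and i+1 are those
   of indices ipred i and i. *)
Definition cup_mate (i : 'I_n) : {ffun pt n -> pt n} :=
  [ffun x => match x with
   | inl k => if k == i then inl (ipred i)
              else if k == ipred i then inl i else inr k
   | inr k => if k == i then inr (ipred i)
              else if k == ipred i then inr i else inl k
   end].

Definition gen_val (i : 'I_n) : {ffun pt n -> pt n} * {set pt n} :=
  if i == 0 :> nat then
    (id_mate, [set x : pt n | match x with inl k | inr k => k == 0 :> nat end])
  else (cup_mate i, set0).

End Product.
Arguments id_mate {n}.

Section FixpointFree.
Variable T : finType.

Lemma even_fpf (f : T -> T) (S : {set T}) :
  {in S, forall x, [/\ f x \in S, f x != x & f (f x) = x]} -> ~~ odd #|S|.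
Proof.
have [k] := ubnP #|S|; elim: k S => // k IH S leS hS.
have [->|[x xS]] := set_0Vmem S; first by rewrite cards0.
have [fxS fxx ffx] := hS x xS.
have fxS' : f x \in S :\ x by rewrite !inE fxx.
have e : #|S| = #|S :\ x :\ f x|.+2.
  by rewrite (cardsD1 x S) xS (cardsD1 (f x) (S :\ x)) fxS'.
rewrite e /= negbK; apply: IH => [|y]; first by rewrite e in leS; apply: ltnW.
rewrite !inE => /and3P[yfx yx yS]; have [fyS fyy ffy] := hS y yS.
split=> //; rewrite fyS andbT; apply/andP; split.
  by apply: contra_neq yx => h; rewrite -ffy h ffx.
by apply: contra_neq yfx => h; rewrite -ffy h.
Qed.

End FixpointFree.

Section Alternating.
Variables (T : finType) (a b : T -> T) (e : rel T).
Hypotheses (aK : involutive a) (bK : involutive b).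
Hypothesis eP : forall u v, e u v -> v = a u \/ v = b u.
Hypothesis ea : forall u, connect e u (a u).
Hypothesis eb : forall u, connect e u (b u).
Hypothesis nofix : forall u, a u = u -> b u <> u.

Let g u := b (a u).

Let g_inj : injective g.
Proof. by move=> u v h; apply/(can_inj aK)/(can_inj bK). Qed.

Let iter_inj k : injective (iter k g).
Proof. by elim: k => [|k IH] u v //= /g_inj /IH. Qed.

Lemma alternating_unique x : b x = x ->
  exists y, [/\ y != x, (a y = y \/ b y = y), connect e x y &
    forall z, z != x -> (a z = z \/ b z = z) -> connect e x z -> z = y].
Proof.
move=> bx; set k := order g x.
have gb i : iter i g (b (iter i g x)) = x.
  elim: i => [|i IH] //=; rewrite -iterS iterSr.
  by rewrite /g bK aK.
have kP m : iter m g x = x -> 0 < m < k + k -> m = k.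
  move=> hm /andP[m0 mk].
  have [lt|ge] := ltnP m k.
    have := order_gt0 g x; rewrite -/k => k0.
    have := orbit_uniq g x; rewrite /orbit -/k => /(uniqP x) /(_ m 0).
    rewrite !inE size_traject => /(_ lt k0); rewrite !nth_traject //= hm.
    by move=> /(_ erefl) m00; rewrite m00 in m0.
  have hmk : iter (m - k) g x = x.
    by apply: (@iter_inj k); rewrite -iterD subnKC // hm iter_order.
  apply/eqP; rewrite eqn_leq ge andbT -subn_eq0; apply: contraT => h.
  have lt : m - k < k by rewrite ltn_subLR.
  have := orbit_uniq g x; rewrite /orbit -/k => /(uniqP x) /(_ (m - k) 0).
  rewrite !inE size_traject => /(_ lt (order_gt0 g x)).
  rewrite !nth_traject ?order_gt0 //= hmk => /(_ erefl) m00.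
  by rewrite m00 in h.
have orb z : connect e x z -> exists2 i, i < k & z = iter i g x.
  suff h : connect e x z -> fconnect g x z.
    move=> /h xz; exists (findex g x z); last by rewrite iter_findex.
    exact: findex_max.
  have fb u : fconnect g x u -> fconnect g x (b u).
    move=> /iter_findex <-; set i := findex _ _ _.
    rewrite fconnect_sym //; have {2}-> : x = iter i g (b (iter i g x)) by [].
    exact: fconnect_iter.
  have fa u : fconnect g x u -> fconnect g x (a u).
    move=> xu; rewrite -[a u]bK; apply: fb; apply: connect_trans xu _.
    exact: fconnect1.
  move=> /connectP[p]; elim/last_ind: p z => [|p y IH] z /=.
    by move=> _ ->.
  rewrite rcons_path last_rcons => /andP[ep] /eP hy ->.
  by case: hy => ->; [apply: fa|apply: fb]; apply: IH.
have reach i : connect e x (iter i g x).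
  elim: i => [|i IH] //=; apply: connect_trans IH _.
  exact: connect_trans (ea _) (eb _).
have fixb i : b (iter i g x) = iter i g x <-> iter (i + i) g x = x.
  split=> [h|h]; first by rewrite iterD -{1}h gb.
  by apply: (@iter_inj i); rewrite gb -iterD h.
have fixa i : a (iter i g x) = iter i g x <-> iter (i + i).+1 g x = x.
  have e1 : a (iter i g x) = b (iter i.+1 g x) by rewrite /= /g bK.
  rewrite e1; split=> [h|h].
    by rewrite -addnS -[in RHS](gb i.+1) h -iterD addSn -addnS.
  by apply: (@iter_inj i.+1); rewrite gb -iterD addSn h.
have k0 : 0 < k := order_gt0 g x.
have k1 : 1 < k.
  rewrite ltn_neqAle k0 andbT; apply/eqP => k1.
  have := fixa 0 => -[_ /=]; have /= -> : iter 1 g x = x by rewrite k1 iter_order.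
  by move=> /(_ erefl) /nofix.
have two : k = odd k + (k./2 + k./2) by rewrite addnn odd_double_half.
have h0 : 0 < k./2 by rewrite half_gt0.
have hk : k./2 < k by rewrite ltn_half_double -addnn -[ltnLHS]addn0 ltn_add2l.
exists (iter k./2 g x); split=> //.
- apply/eqP => h; have := kP _ h; rewrite h0 ltn_addr //= => /(_ isT) h'.
  by rewrite h' ltnn in hk.
- case ok: (odd k) two => /= two.
    by left; apply/fixa; rewrite -add1n -two iter_order.
  by right; apply/fixb; rewrite add0n in two; rewrite -two iter_order.
move=> z zx zfix /orb[i ik zE]; rewrite zE; congr (iter _ g x).
have i0 : 0 < i by rewrite lt0n; apply: contra_neq zx => i0; rewrite zE i0.
case: zfix; rewrite zE.
  have lt : (i + i).+1 < k + k by have := leq_add ik ik; rewrite addSn addnS.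
  move=> /fixa /kP; rewrite /= lt => /(_ isT) h.
  by rewrite -h /= addnn uphalf_double.
move=> /fixb /kP; rewrite addn_gt0 i0 /=.
have -> : i + i < k + k by rewrite -addnS leq_add // ltnW.
move=> /(_ isT) h.
by rewrite -h addnn doubleK.
Qed.

End Alternating.

(* Contracting the part of a graph seen through the embedding h. *)
Section Contraction.
Variables (T W : finType) (h : T -> W) (e' : rel T) (r1 r2 : rel W).
Hypothesis e'1 : forall s t, e' s t -> connect (relU r1 r2) (h s) (h t).
Hypothesis e'2 : forall s t, connect r1 (h s) (h t) -> connect e' s t.
Hypothesis e'3 : forall w w', r2 w w' ->
  exists s t, [/\ w = h s, w' = h t & connect e' s t].

Lemma contractP s w : reflect
  (exists2 t, connect e' s t & connect r1 (h t) w)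
  (connect (relU r1 r2) (h s) w).
Proof.
apply: (iffP idP) => [|[t st tw]]; last first.
  apply: (@connect_trans _ _ (h t)).
    move: st => /connectP[p]; elim/last_ind: p t {tw} => [|p y IH] t /=.
      by move=> _ ->.
    rewrite rcons_path last_rcons => /andP[ep ey] ->.
    exact: connect_trans (IH _ ep erefl) (e'1 ey).
  by apply: connect_sub tw => u v uv; apply: connect1; rewrite /= uv.
move=> /connectP[p]; elim/last_ind: p w => [|p y IH] w /=.
  by move=> _ ->; exists s.
rewrite rcons_path last_rcons => /andP[ep ey] ->.
have [t st tw] := IH _ ep erefl.
case/orP: ey => ey.
  by exists t => //; apply: connect_trans tw (connect1 ey).
have [s' [t' [e1 -> e2]]] := e'3 ey.
exists t'; last exact: connect0.
apply: connect_trans st _; apply: connect_trans e2.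
by apply: e'2; rewrite -e1.
Qed.

Lemma contractE s t : connect (relU r1 r2) (h s) (h t) = connect e' s t.
Proof.
apply/contractP/idP => [[t' st' /e'2]|st]; first exact: connect_trans.
by exists t => //; apply: connect0.
Qed.

End Contraction.

Section DiagramFacts.
Variable n : nat.
Implicit Types (D E : blobbed_TL n) (x y z : pt n).

Lemma TLP D : is_blobbed_TL (mate D, blobs D).
Proof. by case: D => -[m B]. Qed.

Lemma mate_neq D x : mate D x != x.
Proof. by have /and4P[/forallP/(_ x)/andP[]] := TLP D. Qed.

Lemma mateK D : involutive (mate D).
Proof. by move=> x; have /and4P[/forallP/(_ x)/andP[_ /eqP]] := TLP D. Qed.

Lemma mate_nc D x y :
  pos x < pos y -> pos y < pos (mate D x) -> pos (mate D x) < pos (mate D y) ->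
  False.
Proof.
have /and4P[_ /forallP/(_ x)/forallP/(_ y) h _ _] := TLP D.
by move=> h1 h2 h3; rewrite /= h1 h2 h3 in h.
Qed.

Lemma mate_blobs D x : x \in blobs D -> mate D x \in blobs D.
Proof. by have /and4P[_ _ /forall_inP/(_ x)] := TLP D. Qed.

Lemma blobs_exposed D x y : x \in blobs D -> pos y < pos x < pos (mate D y) ->
  False.
Proof.
have /and4P[_ _ _ /forall_inP/(_ x) h] := TLP D.
by move=> /h /forallP/(_ y) /negP.
Qed.

Lemma pos_inj : injective (@pos n).
Proof.
move=> [i|i] [j|j] /=.
- by move=> /val_inj ->.
- by move=> h; have := ltn_ord i; rewrite h ltnNge leq_addr.
- by move=> h; have := ltn_ord j; rewrite -h ltnNge leq_addr.
- by move=> /addnI h; congr inr; apply/rev_ord_inj/val_inj.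
Qed.

Lemma TL_eqP D E : mate D =1 mate E -> blobs D =i blobs E -> D = E.
Proof.
move=> hm hb; apply: val_inj; rewrite /= [LHS]surjective_pairing.
rewrite [RHS]surjective_pairing; congr pair; first exact/ffunP.
exact/setP.
Qed.

(* Parity of the number of points of S before z along the boundary *)

Definition below (S : {set pt n}) z := #|[set p in S | pos p < pos z]|.

Lemma below_mate D (S : {set pt n}) z :
  {in S, forall p, mate D p \in S} -> z \notin S ->
  odd (below S (mate D z)) = odd (below S z).
Proof.
move=> hS zS.
wlog lt : z zS / pos z < pos (mate D z).
  move=> IH; case: (ltngtP (pos z) (pos (mate D z))) => h.
  - exact: IH.
  - have zS' : mate D z \notin S by apply: contra zS => /hS; rewrite mateK.
    by have := IH _ zS'; rewrite mateK => ->.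
  - by move: h => /pos_inj h; have := mate_neq D z; rewrite -h eqxx.
have -> : below S (mate D z) =
    below S z + #|[set p in S | pos z < pos p < pos (mate D z)]|.
  rewrite /below -cardsUI [X in _ = (_ + X)%N](_ : _ = 0); last first.
    apply: eq_card0 => p; rewrite !inE; case: (p \in S) => //=.
    by case: ltngtP.
  rewrite addn0; apply: eq_card => p; rewrite !inE -andb_orr.
  case pS: (p \in S) => //=; case: (ltngtP (pos p) (pos z)) => h /=.
  - exact: ltn_trans lt.
  - by [].
  - by move/pos_inj: h => h; rewrite -h pS in zS.
rewrite oddD; rewrite -[RHS]addbF; congr (_ (+) _); apply/negbTE.
apply: (even_fpf (f := mate D)) => p; rewrite !inE.
move=> /andP[pS /andP[h1 h2]]; split; [|exact: mate_neq|exact: mateK].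
rewrite hS //=; apply/andP; split.
  case: (ltngtP (pos z) (pos (mate D p))) => // h.
    by case: (@mate_nc D (mate D p) z) => //; rewrite mateK.
  by move/pos_inj: h => h; rewrite h hS in zS.
case: (ltngtP (pos (mate D p)) (pos (mate D z))) => // h.
  by case: (@mate_nc D z p).
by move/pos_inj/(can_inj (@mateK D)): h => h; rewrite -h pS in zS.
Qed.

Lemma below_exposed D (S : {set pt n}) q :
  {in S, forall p, mate D p \in S} -> q \notin S -> q \in blobs D ->
  ~~ odd (below S q).
Proof.
move=> hS qS qb; apply: (even_fpf (f := mate D)) => p; rewrite !inE.
move=> /andP[pS pq]; split; [|exact: mate_neq|exact: mateK].
rewrite hS //=; case: (ltngtP (pos (mate D p)) (pos q)) => // h.
  by case: (blobs_exposed qb (y := p)); rewrite pq h.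
by move/pos_inj: h => h; rewrite -h hS in qS.
Qed.

Section Stacked.
Variables D E : blobbed_TL n.

Definition aup (u : stk n) : stk n :=
  match u with inl p => upper (mate D p) | inr i => inr i end.
Definition alow (u : stk n) : stk n :=
  match u with
  | inl (inl i) => inl (inl i)
  | inl (inr i) => lower (mate E (inl i))
  | inr i => lower (mate E (inr i))
  end.

Lemma alow_lower p : alow (lower p) = lower (mate E p).
Proof. by case: p. Qed.

Lemma lower_inj : injective (@lower n).
Proof. by move=> [i|i] [j|j] //= [->]. Qed.

Lemma outer_inj : injective (@outer n).
Proof. by move=> [i|i] [j|j] //= [->]. Qed.

Lemma aupK : involutive aup.
Proof. by move=> [p|i] //=; rewrite mateK. Qed.

Lemma alowK : involutive alow.
Proof. by move=> [[i|i]|i] //=; rewrite alow_lower mateK. Qed.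

Let e := relU (arc_rel (@upper n) (mate D)) (arc_rel (@lower n) (mate E)).

Lemma stacked_edge u v : e u v -> v = aup u \/ v = alow u.
Proof.
case/orP => /existsP[p /andP[/eqP-> /eqP->]]; first by left.
by right; rewrite alow_lower.
Qed.

Lemma stacked_upper p : stacked D E (upper p) (upper (mate D p)).
Proof.
apply: connect1; apply/orP; left; apply/existsP; exists p.
by rewrite !eqxx.
Qed.

Lemma stacked_lower p : stacked D E (lower p) (lower (mate E p)).
Proof.
apply: connect1; apply/orP; right; apply/existsP; exists p.
by rewrite !eqxx.
Qed.

Lemma stacked_aup u : stacked D E u (aup u).
Proof. case: u => [p|i] /=; [exact: stacked_upper|exact: connect0]. Qed.

Lemma stacked_alow u : stacked D E u (alow u).
Proof.
case: u => [[i|i]|i] /=; first exact: connect0.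
- exact: (stacked_lower (inl i)).
- exact: (stacked_lower (inr i)).
Qed.

Lemma outerP (u : stk n) :
  (aup u = u \/ alow u = u) <-> exists x, u = outer x.
Proof.
split=> [|[[i|i] ->]]; [|by right|by left].
case: u => [[i|i]|i] /=; [by exists (inl i)| |by exists (inr i)].
case=> [[h]|]; first by have := mate_neq D (inr i); rewrite h eqxx.
move=> /(@lower_inj _ (inl i)) h.
by have := mate_neq E (inl i); rewrite h eqxx.
Qed.

Lemma stacked_nofix u : aup u = u -> alow u <> u.
Proof.
case: u => [p|i] /=; first by case=> h; have := mate_neq D p; rewrite h eqxx.
move=> _ /(@lower_inj _ (inr i)) h.
by have := mate_neq E (inr i); rewrite h eqxx.
Qed.

Lemma stacked_sym u v : stacked D E u v = stacked D E v u.
Proof.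
apply: sym_connect_sym => {}u {}v; congr orb.
  apply/existsP/existsP => -[p /andP[/eqP-> /eqP->]].
    by exists (mate D p); rewrite mateK !eqxx.
  by exists (mate D p); rewrite mateK !eqxx.
apply/existsP/existsP => -[p /andP[/eqP-> /eqP->]].
  by exists (mate E p); rewrite mateK !eqxx.
by exists (mate E p); rewrite mateK !eqxx.
Qed.

Lemma stacked_unique x : exists y, [/\ y != x,
  stacked D E (outer x) (outer y) &
  forall z, z != x -> stacked D E (outer x) (outer z) -> z = y].
Proof.
have H : exists u : stk n, [/\ u != outer x :> stk n, (aup u = u \/ alow u = u),
    connect e (outer x) u &
    forall z : stk n, z != outer x :> stk n -> (aup z = z \/ alow z = z) ->
      connect e (outer x) z -> z = u].
  case: x => i.
    apply: (alternating_unique aupK alowK stacked_edge) => //.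
    - exact: stacked_aup.
    - exact: stacked_alow.
    - exact: stacked_nofix.
  have [] := @alternating_unique _ alow aup e alowK aupK _ _ _ _ (outer (inr i)).
  - by move=> u v /stacked_edge [] ->; [right|left].
  - exact: stacked_alow.
  - exact: stacked_aup.
  - by move=> u h1 h2; apply: stacked_nofix h1.
  - by [].
  move=> u [h1 h2 h3 h4]; exists u; split=> //; first by case: h2; [right|left].
  by move=> z z1 [] z2; apply: h4 => //; [right|left].
have [u [ux /outerP[y uE] xu uni]] := H; rewrite {}uE in ux xu uni; exists y; split=> //.
  by apply: contraNneq ux => ->.
move=> z zx xz; apply: outer_inj; apply: uni => //.
  by apply: contraNneq zx => /outer_inj ->.
by apply/outerP; exists z.
Qed.

Lemma prod_mateP x :
  [/\ prod_mate D E x != x, stacked D E (outer x) (outer (prod_mate D E x)) &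
  forall z, z != x -> stacked D E (outer x) (outer z) -> z = prod_mate D E x].
Proof.
have [y [yx xy uni]] := stacked_unique x.
suff -> : prod_mate D E x = y by [].
rewrite ffunE; case: pickP => [z /andP[zx xz]|/(_ y)] /=; first exact: uni.
by rewrite yx xy.
Qed.

Lemma prod_mate_uniq x z : z != x -> stacked D E (outer x) (outer z) ->
  prod_mate D E x = z.
Proof. by have [_ _ h] := prod_mateP x => zx xz; rewrite (h z). Qed.

Lemma prod_mateK : involutive (prod_mate D E).
Proof.
move=> x; have [h1 h2 _] := prod_mateP x.
by apply: prod_mate_uniq; rewrite 1?eq_sym // stacked_sym.
Qed.

(* For a union C of curves, the parity of the number of points of C before a
   point is the same seen from D, from E or from the product. *)
Section Parity.
Variable C : {set stk n}.
Hypothesis CP : forall u v, u \in C -> stacked D E u v -> v \in C.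

Let SD := [set p | upper p \in C].
Let SE := [set p | lower p \in C].
Let SO := [set p | outer p \in C].

Definition parity (u : stk n) : bool :=
  match u with
  | inl p => odd (below SD p)
  | inr i => odd (below SE (inr i))
  end.

Let SD_mate : {in SD, forall p, mate D p \in SD}.
Proof. by move=> p; rewrite !inE => h; apply: CP h (stacked_upper p). Qed.

Let SE_mate : {in SE, forall p, mate E p \in SE}.
Proof. by move=> p; rewrite !inE => h; apply: CP h (stacked_lower p). Qed.

Lemma below_inl (S : {set pt n}) (i : 'I_n) :
  below S (inl i) = #|[set j : 'I_n | inl j \in S & j < i]|.
Proof.
rewrite /below -(card_imset _ (@inl_inj 'I_n 'I_n)); apply: eq_card => -[j|j].
  rewrite !inE /=; apply/idP/imsetP => [h|[j' h [->]]]; last by rewrite inE in h.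
  by exists j; rewrite ?inE.
rewrite !inE /=; transitivity false; last by symmetry; apply/imsetP => -[].
by rewrite [_ < i]ltnNge ltnW ?andbF // ltn_addr.
Qed.

Lemma below_inr (S : {set pt n}) (i : 'I_n) :
  below S (inr i) = #|[set j : 'I_n | inl j \in S]|
                    + #|[set j : 'I_n | inr j \in S & i < j]|.
Proof.
rewrite -(card_imset _ (@inl_inj 'I_n 'I_n)).
rewrite -[X in _ + X](card_imset _ (@inr_inj 'I_n 'I_n)).
rewrite -cardsUI [X in _ = _ + X](_ : _ = 0); last first.
  apply: eq_card0 => p; rewrite !inE; apply/negP.
  by case/andP => /imsetP[j _ ->] /imsetP[].
rewrite addn0; apply: eq_card => -[j|j]; rewrite !inE.
  transitivity (inl j \in S).
    by rewrite /= ltn_addr ?andbT.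
  apply/idP/orP => [h|[/imsetP[j' h [->]]|/imsetP[] //]].
    by left; apply/imsetP; exists j; rewrite ?inE.
  by rewrite inE in h.
rewrite /= ltn_add2l.
have -> : (n - j.+1 < n - i.+1) = (i < j).
  by rewrite ltn_sub2lE // ltnS.
apply/idP/orP => [h|[/imsetP[] //|/imsetP[j' h [->]]]].
  by right; apply/imsetP; exists j; rewrite ?inE.
by rewrite inE in h.
Qed.

Let top := #|[set j : 'I_n | inl (inl j) \in C]|.
Let mid := #|[set j : 'I_n | inl (inr j) \in C]|.

Let even_top_mid : odd top = odd mid.
Proof.
have : ~~ odd #|SD|.
  apply: (even_fpf (f := mate D)) => p pS; split; last exact: mateK.
    exact: SD_mate.
  exact: mate_neq.
have -> : #|SD| = top + mid.
  rewrite /top /mid -(card_imset _ (@inl_inj 'I_n 'I_n)).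
  rewrite -[X in _ + X](card_imset _ (@inr_inj 'I_n 'I_n)).
  rewrite -cardsUI [X in _ = _ + X](_ : _ = 0); last first.
    apply: eq_card0 => p; rewrite !inE; apply/negP.
    by case/andP => /imsetP[j _ ->] /imsetP[].
  rewrite addn0; apply: eq_card => -[j|j]; rewrite !inE.
    apply/idP/orP => [h|[/imsetP[j' h [->]]|/imsetP[] //]].
      by left; apply/imsetP; exists j; rewrite ?inE.
    by rewrite inE in h.
  apply/idP/orP => [h|[/imsetP[] //|/imsetP[j' h [->]]]].
    by right; apply/imsetP; exists j; rewrite ?inE.
  by rewrite inE in h.
by rewrite oddD; case: (odd top); case: (odd mid).
Qed.

Lemma parity_upper p : parity (upper p) = odd (below SD p).
Proof. by []. Qed.

Lemma parity_lower p : lower p \notin C -> parity (lower p) = odd (below SE p).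
Proof.
case: p => [i|i] //= iC; rewrite below_inr below_inl oddD.
have -> : #|[set j | inl j \in SD]| = top by apply: eq_card => j; rewrite !inE.
rewrite even_top_mid -oddD.
have -> : mid = #|[set j : 'I_n | inl j \in SE & j < i]|
              + #|[set j : 'I_n | inr j \in SD & i < j]|.
  rewrite -cardsUI [X in _ = _ + X](_ : _ = 0); last first.
    apply: eq_card0 => j; rewrite !inE /=.
    by case: ltngtP; rewrite ?andbF.
  rewrite addn0; apply: eq_card => j; rewrite !inE /upper /= -andb_orr.
  case jC: (_ \in C) => //=; case: (ltngtP j i) => // /val_inj ji.
  by rewrite -ji jC in iC.
by rewrite -addnA addnn oddD odd_double addbF.
Qed.

Lemma parity_outer p : parity (outer p) = odd (below SO p).
Proof.
case: p => [i|i] /=.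
  by rewrite !below_inl; congr odd; apply: eq_card => j; rewrite !inE.
rewrite !below_inr !oddD; congr (_ (+) _).
  transitivity (odd mid); first by congr odd; apply: eq_card => j; rewrite !inE.
  by rewrite -even_top_mid; congr odd; apply: eq_card => j; rewrite !inE.
by congr odd; apply: eq_card => j; rewrite !inE.
Qed.

Lemma parity_stacked u v : u \notin C -> stacked D E u v -> parity v = parity u.
Proof.
move=> uC /connectP[p]; elim/last_ind: p v => [|p y IH] v /=.
  by move=> _ ->.
rewrite rcons_path last_rcons => /andP[ep ey] ->.
have {IH} <- := IH _ ep erefl.
have wC : last u p \notin C.
  apply: contra uC => wC; apply: CP wC _; rewrite stacked_sym.
  by apply/connectP; exists p.
case/orP: ey => /existsP[q /andP[/eqP wE /eqP ->]]; rewrite wE in wC *.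
  by rewrite !parity_upper below_mate // inE.
rewrite !parity_lower ?below_mate ?inE //.
apply: contra wC => h; apply: CP h _; rewrite stacked_sym.
exact: stacked_lower.
Qed.

End Parity.

Let curve x : {set stk n} := [set u | stacked D E (outer x) u].

Let curveP x u v : u \in curve x -> stacked D E u v -> v \in curve x.
Proof. rewrite !inE; exact: connect_trans. Qed.

Let curve_outer x y : (outer y \in curve x) = (y == x) || (y == prod_mate D E x).
Proof.
rewrite inE; have [_ h1 h2] := prod_mateP x.
have [->|yx] := eqVneq y x; first exact: connect0.
by apply/idP/eqP => [|->] //; apply: h2.
Qed.

Let below_curve x z : pos x < pos (prod_mate D E x) ->
  odd (below [set p | outer p \in curve x] z) =
  (pos x < pos z <= pos (prod_mate D E x)).
Proof.
move=> lt; have [neq _ _] := prod_mateP x.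
rewrite /below; set P := (X in #|pred_of_set X|).
have PE : P = [set p in [:: x; prod_mate D E x] | pos p < pos z].
  by apply/setP => p; rewrite !inE -curve_outer inE.
rewrite PE; case: (ltnP (pos x) (pos z)) => h1; last first.
  rewrite (_ : [set _ in _ | _] = set0) ?cards0 //.
  apply/setP => p; rewrite !inE; apply/negP => /andP[/orP[]/eqP->].
    by rewrite ltnNge h1.
  by rewrite ltnNge (leq_trans h1) // ltnW.
case: (leqP (pos z) (pos (prod_mate D E x))) => h2 /=.
  rewrite (_ : [set _ in _ | _] = [set x]) ?cards1 //.
  apply/setP => p; rewrite !inE; have [->|] := eqVneq p x; first by rewrite h1.
  by move=> _ /=; apply/negP => /andP[/eqP->]; rewrite ltnNge h2.
rewrite (_ : [set _ in _ | _] = [set x; prod_mate D E x]).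
  by rewrite cards2 eq_sym neq.
apply/setP => p; rewrite !inE; have [->|] := eqVneq p x; first by rewrite h1.
by move=> _ /=; have [->|//] := eqVneq p _; rewrite h2.
Qed.

Lemma prod_noncrossing x y :
  ~~ [&& pos x < pos y, pos y < pos (prod_mate D E x)
       & pos (prod_mate D E x) < pos (prod_mate D E y)].
Proof.
apply/and3P => -[h1 h2 h3].
have lt := ltn_trans h1 h2.
have yC : outer y \notin curve x.
  rewrite curve_outer; apply/norP; split; apply/eqP => h.
    by rewrite h ltnn in h1.
  by rewrite h ltnn in h2.
have [_ yy _] := prod_mateP y.
have := parity_stacked (@curveP x) yC yy.
rewrite !(parity_outer (@curveP x)) !below_curve // h1 (ltnW h2).
by rewrite [pos (prod_mate D E y) <= _]leqNgt h3 andbF.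
Qed.

Lemma prod_blobs_mate x : x \in prod_blobs D E ->
  prod_mate D E x \in prod_blobs D E.
Proof.
have [_ h _] := prod_mateP x; rewrite stacked_sym in h.
rewrite !inE => /orP[]/exists_inP[q qb xq]; apply/orP; [left|right].
  by apply/exists_inP; exists q => //; apply: connect_trans xq.
by apply/exists_inP; exists q => //; apply: connect_trans xq.
Qed.

Lemma prod_blobs_exposed x y : x \in prod_blobs D E ->
  ~~ (pos y < pos x < pos (prod_mate D E y)).
Proof.
move=> xb; apply/negP => /andP[h1 h2].
have lt := ltn_trans h1 h2.
have xC : outer x \notin curve y.
  rewrite curve_outer; apply/norP; split; apply/eqP => h.
    by rewrite h ltnn in h1.
  by rewrite h ltnn in h2.
have xo : parity (curve y) (outer x).
  by rewrite (parity_outer (@curveP y)) below_curve // h1 ltnW.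
have cC u : stacked D E (outer x) u -> u \notin curve y.
  move=> xu; apply: contra xC => uC.
  by apply: (curveP uC); rewrite stacked_sym.
move: xb; rewrite inE => /orP[]/exists_inP[q qb xq].
  have := parity_stacked (@curveP y) xC xq.
  rewrite xo parity_upper; apply/negP.
  apply: (@below_exposed D) => //.
    by move=> p; rewrite !inE => h; apply: connect_trans h (stacked_upper p).
  by have := cC _ xq; rewrite !inE.
have := parity_stacked (@curveP y) xC xq.
rewrite xo parity_lower; last exact: cC; last exact: (@curveP y).
apply/negP.
apply: (@below_exposed E) => //.
  by move=> p; rewrite !inE => h; apply: connect_trans h (stacked_lower p).
by have := cC _ xq; rewrite !inE.
Qed.

Lemma prod_subproof : is_blobbed_TL (prod_mate D E, prod_blobs D E).
Proof.
apply/and4P; split=> /=.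
- apply/forallP => x; have [-> _ _] := prod_mateP x.
  by rewrite prod_mateK eqxx.
- by apply/forallP => x; apply/forallP => y; apply: prod_noncrossing.
- by apply/forall_inP; apply: prod_blobs_mate.
- apply/forall_inP => x xb; apply/forallP => y; exact: prod_blobs_exposed.
Qed.

Definition TL_mul : blobbed_TL n := BlobbedTL prod_subproof.

End Stacked.
End DiagramFacts.

Section Triple.
Variables (n : nat) (D E F : blobbed_TL n) (W : finType).
Variables (k h : stk n -> W) (f g : pt n -> stk n).
Hypotheses (k_inj : injective k) (h_inj : injective h).
Hypothesis hf : forall p, h (f p) = k (outer p).
Hypothesis h_cases : forall s, (exists p, s = f p) \/ (forall u, h s <> k u).

Let r1 : rel W := relU (arc_rel (k \o @upper n) (mate D))
                       (arc_rel (k \o @lower n) (mate E)).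
Let r2 : rel W := arc_rel (h \o g) (mate F).
Let e' : rel (stk n) := relU (arc_rel f (mate (TL_mul D E))) (arc_rel g (mate F)).

Lemma triple_r1P u w :
  reflect (exists2 v, w = k v & stacked D E u v) (connect r1 (k u) w).
Proof.
apply: (iffP idP) => [/connectP[p]|[v -> /connectP[p]]].
  elim/last_ind: p w => [|p y IH] w /=; first by move=> _ ->; exists u => //; apply: connect0.
  rewrite rcons_path last_rcons => /andP[ep ey] ->.
  have [v vE uv] := IH _ ep erefl; move: ey; rewrite vE.
  case/orP => /existsP[q /andP[/eqP/k_inj vq /eqP ->]].
    exists (upper (mate D q)) => //; apply: connect_trans uv _.
    by rewrite vq; apply: stacked_upper.
  exists (lower (mate E q)) => //; apply: connect_trans uv _.
  by rewrite vq; apply: stacked_lower.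
elim/last_ind: p v => [|p y IH] v /=; first by move=> _ ->.
rewrite rcons_path last_rcons => /andP[ep ey] ->.
apply: connect_trans (IH _ ep erefl) (connect1 _).
case/orP: ey => /existsP[q /andP[/eqP -> /eqP ->]]; apply/orP; [left|right].
  by apply/existsP; exists q; rewrite /= !eqxx.
by apply/existsP; exists q; rewrite /= !eqxx.
Qed.

Lemma triple_r1_out w w' : (forall u, w <> k u) -> connect r1 w w' -> w = w'.
Proof.
move=> hw /connectP[[|y p] /=]; first by move=> _ ->.
by case/andP => /orP[]/existsP[q /andP[/eqP/hw]].
Qed.

Lemma triple_hr1 t u : connect r1 (h t) (k u) ->
  exists2 y, t = f y & stacked D E (outer y) u.
Proof.
case: (h_cases t) => [[y ->]|ht /(triple_r1_out ht)/ht//].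
by rewrite hf => /triple_r1P[v /k_inj <- ?]; exists y.
Qed.

Lemma triple_e1 s t : e' s t -> connect (relU r1 r2) (h s) (h t).
Proof.
case/orP => /existsP[p /andP[/eqP -> /eqP ->]].
  rewrite !hf; apply: (@connect_sub _ r1) => [u v uv|].
    by apply: connect1; rewrite /= uv.
  apply/triple_r1P; exists (outer (prod_mate D E p)) => //.
  by have [] := prod_mateP D E p.
by apply: connect1; apply/orP; right; apply/existsP; exists p; rewrite !eqxx.
Qed.

Lemma triple_e2 s t : connect r1 (h s) (h t) -> connect e' s t.
Proof.
case: (h_cases t) => [[q ->]|ht].
  rewrite hf => /triple_hr1[p -> pq].
  have [->|qp] := eqVneq q p; first exact: connect0.
  rewrite -(prod_mate_uniq qp pq); apply: connect1; apply/orP; left.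
  by apply/existsP; exists p; rewrite !eqxx.
case: (h_cases s) => [[p ->]|hs].
  by rewrite hf => /triple_r1P[v /ht].
by move=> /(triple_r1_out hs)/h_inj ->; apply: connect0.
Qed.

Lemma triple_e3 w w' : r2 w w' ->
  exists s t, [/\ w = h s, w' = h t & connect e' s t].
Proof.
case/existsP => p /andP[/eqP -> /eqP ->].
exists (g p), (g (mate F p)); split=> //.
by apply: connect1; apply/orP; right; apply/existsP; exists p; rewrite !eqxx.
Qed.

Lemma tripleE s t : connect (relU r1 r2) (h s) (h t) = connect e' s t.
Proof. exact: (contractE triple_e1 triple_e2 triple_e3). Qed.

Lemma triple_blobs x :
  [exists y in blobs (TL_mul D E), connect e' (outer x) (f y)]
  = [exists y in blobs D, connect (relU r1 r2) (h (outer x)) (k (upper y))]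
 || [exists y in blobs E, connect (relU r1 r2) (h (outer x)) (k (lower y))].
Proof.
have sub u w : connect r1 u w -> connect (relU r1 r2) u w.
  by apply: connect_sub => {}u v uv; apply: connect1; rewrite /= uv.
apply/exists_inP/orP => [[y yb xy]|].
  rewrite -tripleE hf in xy; move: yb; rewrite inE.
  case/orP=> /exists_inP[q qb yq]; [left|right]; apply/exists_inP; exists q => //;
    by apply: connect_trans xy _; apply: sub; apply/triple_r1P; eexists.
by case=> /exists_inP[q qb /(contractP triple_e1 triple_e2 triple_e3)];
  move=> [t xt /triple_hr1[y tE yq]]; exists y; rewrite -?tE // inE;
  apply/orP; [left|right]; apply/exists_inP; exists q.
Qed.

End Triple.

Lemma arc_rel_eq (S T : finType) (f f' : S -> T) :
  f =1 f' -> forall m, arc_rel f m =2 arc_rel f' m.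
Proof. by move=> ff m u v; apply: eq_existsb => p; rewrite !ff. Qed.

Section TLMonoid.
Variable n : nat.
Implicit Types D E F : blobbed_TL n.

Notation quad := (stk n + 'I_n)%type.

Let k12 (u : stk n) : quad := inl u.
Let h12 (u : stk n) : quad :=
  match u with
  | inl (inl i) => inl (inl (inl i))
  | inl (inr i) => inl (inr i)
  | inr i => inr i
  end.
Let k23 (u : stk n) : quad :=
  match u with
  | inl (inl i) => inl (inl (inr i))
  | inl (inr i) => inl (inr i)
  | inr i => inr i
  end.
Let h23 (u : stk n) : quad :=
  match u with
  | inl (inl i) => inl (inl (inl i))
  | inl (inr i) => inl (inl (inr i))
  | inr i => inr i
  end.

Lemma TL_mulA : associative (@TL_mul n).
Proof.
move=> D E F.
have k12i : injective k12 by move=> u v [].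
have h12i : injective h12 by move=> [[i|i]|i] [[j|j]|j] //= [->].
have k23i : injective k23 by move=> [[i|i]|i] [[j|j]|j] //= [->].
have h23i : injective h23 by move=> [[i|i]|i] [[j|j]|j] //= [->].
have hf12 p : h12 (upper p) = k12 (outer p) by case: p.
have hf23 p : h23 (lower p) = k23 (outer p) by case: p.
have c12 s : (exists p, s = @upper n p) \/ (forall u, h12 s <> k12 u).
  by case: s => [p|i]; [left; exists p|right].
have c23 s : (exists p, s = @lower n p) \/ (forall u, h23 s <> k23 u).
  case: s => [[i|i]|i]; [right; by case=> [[]|]|left; by exists (inl i)|].
  by left; exists (inr i).
have ew3 p : k23 (lower p) = h12 (lower p) by case: p.
have ew2 p : k23 (upper p) = k12 (lower p) by case: p.
have ew1 p : h23 (upper p) = k12 (upper p) by case: p.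
have eo p : h23 (outer p) = h12 (outer p) by case: p.
set r12 : rel quad :=
  relU (relU (arc_rel (k12 \o @upper n) (mate D))
             (arc_rel (k12 \o @lower n) (mate E)))
       (arc_rel (h12 \o @lower n) (mate F)).
set r23 : rel quad :=
  relU (relU (arc_rel (k23 \o @upper n) (mate E))
             (arc_rel (k23 \o @lower n) (mate F)))
       (arc_rel (h23 \o @upper n) (mate D)).
have rE : connect r23 =2 connect r12.
  apply: eq_connect => u v.
  have := arc_rel_eq ew1 (mate D) u v; have := arc_rel_eq ew2 (mate E) u v.
  have := arc_rel_eq ew3 (mate F) u v; rewrite /r12 /r23 /= => -> -> ->.
  by rewrite orbC orbA.
have L s t : stacked (TL_mul D E) F s t = connect r12 (h12 s) (h12 t).
  by symmetry; apply: tripleE.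
have swap : stacked D (TL_mul E F) =2
    connect (relU (arc_rel (@lower n) (mate (TL_mul E F)))
                  (arc_rel (@upper n) (mate D))).
  by apply: eq_connect => u v /=; rewrite orbC.
have R s t : stacked D (TL_mul E F) s t = connect r12 (h23 s) (h23 t).
  by rewrite -rE swap; symmetry; apply: tripleE.
apply: TL_eqP => x.
  have [h1 h2 _] := prod_mateP (TL_mul D E) F x.
  by apply: prod_mate_uniq => //; rewrite R !eo -L.
rewrite !inE.
have -> : [exists y in blobs (TL_mul E F),
      stacked D (TL_mul E F) (outer x) (lower y)] =
    [exists y in blobs E, connect r12 (h12 (outer x)) (k12 (lower y))]
 || [exists y in blobs F, connect r12 (h12 (outer x)) (h12 (lower y))].
  under eq_existsb => y do rewrite swap.
  rewrite (triple_blobs E F D (@upper n) k23i h23i hf23 c23).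
  congr (_ || _); apply: eq_existsb => y; rewrite rE eo ?ew2 ?ew3 //.
have -> : [exists y in blobs (TL_mul D E),
      stacked (TL_mul D E) F (outer x) (upper y)] =
    [exists y in blobs D, connect r12 (h12 (outer x)) (k12 (upper y))]
 || [exists y in blobs E, connect r12 (h12 (outer x)) (k12 (lower y))].
  exact: triple_blobs.
rewrite orbA; congr (_ || _ || _); apply: eq_existsb => y.
  by rewrite R eo ew1.
by rewrite L.
Qed.

Lemma id_subproof (B : {set pt n}) :
  (forall k : 'I_n, (inl k \in B) = (inr k \in B)) ->
  (forall k : 'I_n, inl k \in B -> k = 0 :> nat) ->
  is_blobbed_TL (id_mate, B).
Proof.
move=> B1 B2; have idE x : id_mate x = match x with inl k => inr k | inr k => inl k end.
  by rewrite ffunE.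
have posr (j : 'I_n) : n <= pos (inr j : pt n) by rewrite leq_addr.
apply/and4P; split=> /=.
- by apply/forallP => -[k|k]; rewrite !idE /= eqxx.
- apply/forallP => x; apply/forallP => y; rewrite !idE; apply/and3P.
  case: x y => [i|i] [j|j] [] /= h1 h2 h3.
  + by move: h3; rewrite ltn_add2l ltnNge leq_sub2l // ltnW.
  + by move: h3; rewrite ltnNge (leq_trans (ltnW (ltn_ord j))) ?leq_addr.
  + by move: h1; rewrite ltnNge (leq_trans (ltnW (ltn_ord j))) ?leq_addr.
  + by move: h2; rewrite ltnNge (leq_trans (ltnW (ltn_ord i))) ?leq_addr.
- by apply/forall_inP => -[k|k]; rewrite idE ?B1 // -B1.
- apply/forall_inP => x xB; apply/forallP => y; rewrite idE; apply/negP.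
  case: x y xB => [i|i] [j|j] /= xB /andP[] h1 h2.
  + by rewrite (B2 _ xB) in h1.
  + by rewrite (B2 _ xB) in h1.
  + rewrite -B1 in xB; rewrite ltn_add2l (B2 _ xB) in h2.
    by move: h2; rewrite ltnNge leq_sub2l.
  + by move: h2; rewrite ltnNge (leq_trans (ltnW (ltn_ord j))) ?leq_addr.
Qed.

Lemma one_subproof : is_blobbed_TL (@id_mate n, set0).
Proof. by apply: id_subproof => k; rewrite !inE. Qed.

Definition TL_one : blobbed_TL n := BlobbedTL one_subproof.

Lemma TL_mul1x : left_id TL_one (@TL_mul n).
Proof.
move=> D.
have out_low x : stacked TL_one D (outer x) (lower x).
  case: x => k; last exact: connect0.
  by have := stacked_upper TL_one D (inl k); rewrite ffunE.
have E : mate (TL_mul TL_one D) =1 mate D.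
  move=> x; apply: prod_mate_uniq; first exact: mate_neq.
  apply: connect_trans (out_low x) _; rewrite -/(stacked _ _ _ _).
  apply: connect_trans (stacked_lower TL_one D x) _.
  by rewrite -/(stacked _ _ _ _) stacked_sym.
apply: TL_eqP => // x; rewrite inE.
apply/orP/idP => [[/exists_inP[q]|/exists_inP[q qb xq]]|xb].
- by rewrite inE.
- have [_ _ h] := prod_mateP TL_one D x; have [<-//|qx] := eqVneq q x.
  have qE := E x; rewrite /= -(h q qx) in qE; last first.
    apply: connect_trans xq _.
    by rewrite -/(stacked _ _ _ _) stacked_sym.
  by rewrite -[x](mateK D) mate_blobs // -qE.
- by right; apply/exists_inP; exists x.
Qed.

Lemma TL_mulx1 : right_id TL_one (@TL_mul n).
Proof.
move=> D.
have out_up x : stacked D TL_one (outer x) (upper x).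
  case: x => k; first exact: connect0.
  by have := stacked_lower D TL_one (inr k); rewrite ffunE.
have E : mate (TL_mul D TL_one) =1 mate D.
  move=> x; apply: prod_mate_uniq; first exact: mate_neq.
  apply: connect_trans (out_up x) _; rewrite -/(stacked _ _ _ _).
  apply: connect_trans (stacked_upper D TL_one x) _.
  by rewrite -/(stacked _ _ _ _) stacked_sym.
apply: TL_eqP => // x; rewrite inE.
apply/orP/idP => [[/exists_inP[q qb xq]|/exists_inP[q]]|xb].
- have [_ _ h] := prod_mateP D TL_one x; have [<-//|qx] := eqVneq q x.
  have qE := E x; rewrite /= -(h q qx) in qE; last first.
    apply: connect_trans xq _.
    by rewrite -/(stacked _ _ _ _) stacked_sym.
  by rewrite -[x](mateK D) mate_blobs // -qE.
- by rewrite inE.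
- by left; apply/exists_inP; exists x.
Qed.

HB.instance Definition _ :=
  isMonoid.Build (blobbed_TL n) TL_mulA TL_mul1x TL_mulx1.

Lemma gen_subproof (i : 'I_n) : is_blobbed_TL (gen_val i).
Proof.
rewrite /gen_val; case: eqP => [_|/eqP].
  by apply: id_subproof => k; rewrite !inE // => /eqP.
rewrite -lt0n => i0.
have iP : (ipred i).+1 = i by rewrite /= prednK.
have pi : (ipred i == i) = false by rewrite -val_eqE -[val i]iP ltn_eqF.
apply/and4P; split=> /=; last 2 first.
- by apply/forall_inP => x; rewrite inE.
- by apply/forall_inP => x; rewrite inE.
- apply/forallP => -[k|k]; rewrite !ffunE.
  + have [->|ki] := eqVneq k i; first by rewrite pi !eqxx (inj_eq inl_inj) pi.
    have [->|kp] := eqVneq k (ipred i).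
      by rewrite !eqxx (inj_eq inl_inj) eq_sym pi.
    by rewrite (negbTE ki) (negbTE kp) eqxx.
  + have [->|ki] := eqVneq k i; first by rewrite pi !eqxx (inj_eq inr_inj) pi.
    have [->|kp] := eqVneq k (ipred i).
      by rewrite !eqxx (inj_eq inr_inj) eq_sym pi.
    by rewrite (negbTE ki) (negbTE kp) eqxx.
- apply/forallP => x; apply/forallP => y; rewrite !ffunE.
  have := ltn_ord i.
  case: x y => [j|j] [k|k]; have := ltn_ord j; have := ltn_ord k;
    rewrite -!val_eqE /=; do 4?case: ifP => //=; lia.
Qed.

Definition TL_gen (i : 'I_n) : blobbed_TL n := BlobbedTL (gen_subproof i).

End TLMonoid.

(* Main.v *)
Require Import Defs.
From mathcomp Require Import all_boot.
From mathcomp Require Import zify.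

(* Read along the boundary of the strip, a diagram is a word of opening and closing
   letters, with blobs, which determines it. For a diagram which is the identity
   after the first N strands, multiplying on the right by u_N u_(N-1) ... u_k
   (k = N + 1 giving the empty product) inserts a short arc at position 2N + 1 - k of
   the word; the last factor u_0 puts a blob on the short arc at the end.
   Every word arises from the empty one by insertions in a unique way if each
   inserted arc is required to be the last short arc, so the corresponding products
   of blocks represent every diagram exactly once. In the blob monoid, every element is
   such a product: the generator of largest index is needed at most once, which
   gives a product of blocks, and two blocks in the wrong order are exchanged by
   [block_swap], which mirrors the commutation of two insertions. *)

Set Implicit Arguments.
Unset Strict Implicit.
Unset Printing Implicit Defensive.

(** * Right multiplication by a generator *)

Lemma stacked_closed n (D E : blobbed_TL n) (C : {pred stk n}) u v :
  (forall w, w \in C -> aup D w \in C /\ alow E w \in C) ->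
  u \in C -> stacked D E u v -> v \in C.
Proof.
move=> hC uC /connectP[p]; elim: p u uC => [|w p IH] u uC /=; first by move=> _ ->.
by case/andP=> /stacked_edge[] -> pw vE; apply: IH pw vE; case: (hC _ uC).
Qed.

Lemma stacked_trans n (D E : blobbed_TL n) u v w :
  stacked D E u v -> stacked D E v w -> stacked D E u w.
Proof. exact: connect_trans. Qed.

Section RightMultiplication.
Variables (n : nat) (D : blobbed_TL n) (i : 'I_n).

Section Cup.
Hypothesis i_gt0 : 0 < i.

Let a : pt n := inr (ipred i).
Let b : pt n := inr i.

Let ipredF : (ipred i == i) = false.
Proof. by apply/negbTE; rewrite -val_eqE /= neq_ltn ltn_predL i_gt0. Qed.

Let abF : (a == b) = false.
Proof. by rewrite /a /b (inj_eq inr_inj) ipredF. Qed.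

Lemma mate_cup : mate (TL_gen i) = cup_mate i.
Proof. by rewrite /mate /= /gen_val eqn0Ngt i_gt0. Qed.

Lemma blobs_cup : blobs (TL_gen i) = set0.
Proof. by rewrite /blobs /= /gen_val eqn0Ngt i_gt0. Qed.

(** Away from the cup the generator consists of vertical strands, so an endpoint of [D] continues to
    the outer point with the same label. *)
Let thru q : q != a -> q != b -> stacked D (TL_gen i) (upper q) (outer q).
Proof.
case: q => [k|k] qa qb; first exact: connect0.
have := stacked_lower D (TL_gen i) (inl k).
move: qa qb; rewrite mate_cup ffunE /a /b !(inj_eq inr_inj).
by move=> /negbTE -> /negbTE ->.
Qed.

Let turn : stacked D (TL_gen i) (upper a) (upper b).
Proof.
by have := stacked_lower D (TL_gen i) (inl (ipred i));
  rewrite mate_cup ffunE ipredF eqxx.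
Qed.

Let cap : stacked D (TL_gen i) (outer a) (outer b).
Proof.
by have := stacked_lower D (TL_gen i) (inr (ipred i));
  rewrite mate_cup ffunE ipredF eqxx.
Qed.

Let sym := stacked_sym D (TL_gen i).

(** [a] and [b] label bottom points of [D] and of the product alike: the generator merges the arcs
    of [D] through them and joins the new [a] and [b]. *)
Definition cap_mate (x : pt n) : pt n :=
  if x == b then a else if x == a then b
  else if mate D x == b then mate D a
  else if mate D x == a then mate D b else mate D x.

Definition cap_blobs (x : pt n) : bool :=
  [&& x != a, x != b &
      [|| x \in blobs D, (mate D x == b) && (a \in blobs D)
        | (mate D x == a) && (b \in blobs D)]].

(** By [prod_mate_uniq] it is enough to trace a curve from [x] to the claimed endpoint, case by
    case. *)
Lemma mate_mul_cup x : mate (TL_mul D (TL_gen i)) x = cap_mate x.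
Proof.
apply: prod_mate_uniq; rewrite /cap_mate.
  have [->|xb] := eqVneq x b; first by rewrite abF.
  have [->|xa] := eqVneq x a; first by rewrite eq_sym abF.
  have [e|_] := eqVneq (mate D x) b.
    apply: contraFneq abF => e'; apply/eqP/(can_inj (mateK D)).
    by rewrite e' -e mateK.
  have [e|_] := eqVneq (mate D x) a; last exact: mate_neq.
  apply: contraFneq abF => e'; apply/eqP/(can_inj (mateK D)).
  by rewrite -e mateK e'.
have [->|xb] := eqVneq x b; first by rewrite sym.
have [->|xa] := eqVneq x a; first by [].
have xu : stacked D (TL_gen i) (outer x) (upper (mate D x)).
  by apply: stacked_trans (stacked_upper _ _ _); rewrite sym; apply: thru.
have [e|mb] := eqVneq (mate D x) b.
  apply: stacked_trans xu _; rewrite e.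
  have ma : mate D a != a := mate_neq D a.
  apply: stacked_trans (thru ma _); last first.
    by apply: contraNneq xa => h; rewrite -(mateK D x) e -h mateK.
  by apply: stacked_trans (stacked_upper _ _ _); rewrite sym.
have [e|ma] := eqVneq (mate D x) a; last exact: stacked_trans xu (thru ma mb).
apply: stacked_trans xu _; rewrite e.
apply: stacked_trans (thru _ (mate_neq D b)); last first.
  by apply: contraNneq xb => h; rewrite -(mateK D x) e -h mateK.
exact: stacked_trans turn (stacked_upper _ _ _).
Qed.

Let uniq_curve x y : stacked D (TL_gen i) (outer x) (outer y) -> y != x ->
  y = cap_mate x.
Proof. by move=> h yx; rewrite -mate_mul_cup [RHS](prod_mate_uniq yx h). Qed.

Lemma blobs_mul_cup x : (x \in blobs (TL_mul D (TL_gen i))) = cap_blobs x.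
Proof.
have mb q : (mate D q \in blobs D) = (q \in blobs D).
  by apply/idP/idP => /mate_blobs //; rewrite mateK.
rewrite inE blobs_cup.
have -> : [exists y in set0, stacked D (TL_gen i) (outer x) (lower y)] = false.
  by apply/exists_inP => -[y]; rewrite inE.
rewrite orbF; apply/exists_inP/idP => [[y yB xy]|/and3P[xa xb]].
  (* A blob found at [a] or [b] is read at the other end of its arc. If that end is [a] or [b] too,
     the curve is a closed loop, which meets no outer point. *)
  wlog [ya yb] : y yB xy / y != a /\ y != b.
    move=> IH; have [/andP[]|/nandP yab] := boolP ((y != a) && (y != b));
      first by move=> *; apply: (IH y).
    have xmy : stacked D (TL_gen i) (outer x) (upper (mate D y)).
      exact: stacked_trans xy (stacked_upper _ _ _).
    have [/andP[]|/nandP myab] := boolP ((mate D y != a) && (mate D y != b)).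
      by move=> *; apply: (IH (mate D y)) => //; rewrite mb.
    have mab : mate D a = b /\ mate D b = a.
      have na := mate_neq D a; have nb := mate_neq D b; have ka := mateK D a;
        have kb := mateK D b.
      case: yab myab => /negPn/eqP -> [] /negPn/eqP h; rewrite h in na nb ka kb;
        by rewrite ?eqxx in na nb.
    have : outer x \in [pred w | (w == upper a) || (w == upper b)].
      apply: (@stacked_closed _ D (TL_gen i) _ (upper y)); last by rewrite sym.
        move=> w /orP[] /eqP -> /=;
          rewrite mate_cup !ffunE ?ipredF ?eqxx /= ?mab.1 ?mab.2.
          by rewrite !inE !eqxx ?orbT.
        by rewrite !inE !eqxx ?orbT.
      by rewrite inE; case: yab => /negPn/eqP ->; rewrite eqxx ?orbT.
    by case: (x).
  have xoy := stacked_trans xy (thru ya yb).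
  have [e|yx] := eqVneq y x; first by rewrite /cap_blobs -e ya yb yB.
  have := uniq_curve xoy yx; rewrite /cap_blobs /cap_mate.
  have [_ e|xb] := eqVneq x b; first by rewrite e eqxx in ya.
  have [_ e|xa] := eqVneq x a; first by rewrite e eqxx in yb.
  have [e e'|nb] := eqVneq (mate D x) b; first by rewrite -(mb a) -e' yB orbT.
  have [e e'|na] := eqVneq (mate D x) a; first by rewrite -(mb b) -e' yB !orbT.
  by move=> e; rewrite -(mb x) -e yB.
have xu : stacked D (TL_gen i) (outer x) (upper x) by rewrite sym thru.
case/or3P=> [xB|/andP[/eqP e h]|/andP[/eqP e h]].
- by exists x.
- exists a => //; apply: stacked_trans xu _;
  apply: stacked_trans (stacked_upper _ _ _) _.
  by rewrite e sym.
- exists b => //; apply: stacked_trans xu _;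
  apply: stacked_trans (stacked_upper _ _ _) _.
  by rewrite e.
Qed.

End Cup.

Section Blob.
Hypothesis i0 : i = 0 :> nat.

Let mate_blob : mate (TL_gen i) = id_mate.
Proof. by rewrite /mate /= /gen_val i0. Qed.

Let blobs_blob x : (x \in blobs (TL_gen i)) = match x with inl k | inr k => k == i end.
Proof. by rewrite /blobs /= /gen_val i0 inE; case: x => k; rewrite -val_eqE /= i0. Qed.

Let thru q : stacked D (TL_gen i) (upper q) (outer q).
Proof.
case: q => k; first exact: connect0.
by have := stacked_lower D (TL_gen i) (inl k); rewrite mate_blob ffunE.
Qed.

Lemma mate_mul_blob x : mate (TL_mul D (TL_gen i)) x = mate D x.
Proof.
apply: prod_mate_uniq; first exact: mate_neq.
apply: stacked_trans (thru _); apply: stacked_trans (stacked_upper _ _ _).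
by rewrite stacked_sym.
Qed.

Lemma blobs_mul_blob x : (x \in blobs (TL_mul D (TL_gen i))) =
  [|| x \in blobs D, x == inr i | mate D x == inr i].
Proof.
have ou y : stacked D (TL_gen i) (outer y) (upper y) by rewrite stacked_sym.
have curve y : stacked D (TL_gen i) (outer x) (outer y) -> y = x \/ mate D x = y.
  move=> h; have [->|yx] := eqVneq y x; [by left|right].
  by rewrite -mate_mul_blob [LHS](prod_mate_uniq yx h).
rewrite inE; apply/orP/or3P => [[/exists_inP[y yB h]|/exists_inP[y yB h]]|].
- case: (curve y (stacked_trans h (thru y))) => [<-|e]; first by constructor 1.
  by constructor 1; rewrite -(mateK D x) mate_blobs // e.
- have /curve : stacked D (TL_gen i) (outer x) (outer (inr i)).
    apply: stacked_trans h _; rewrite blobs_blob in yB.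
    by case: y yB => k /eqP ->; [apply: (thru (inr i))|apply: connect0].
  by case=> [<-|e]; [constructor 2|constructor 3; rewrite e].
- case=> [h|/eqP->|/eqP e]; first by left; apply/exists_inP; exists x.
    right; apply/exists_inP; exists (inr i); first by rewrite blobs_blob.
    exact: connect0.
  right; apply/exists_inP; exists (inr i); first by rewrite blobs_blob.
  apply: (stacked_trans (ou x)); apply: (stacked_trans (stacked_upper _ _ _)).
  by rewrite e; apply: thru.
Qed.

End Blob.
End RightMultiplication.

(** * Diagrams as matchings of ranks *)

Section Positions.
Variable n : nat.
Implicit Types (D E : blobbed_TL n) (x : pt n) (i : 'I_n).

(* [partner D p] is the junk value [0] when [p] is not the rank of a point. *)
Definition partner D (p : nat) : nat :=
  if [pick x : pt n | pos x == p] is Some x then pos (mate D x) else 0.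

Definition blob_at D (p : nat) : bool := [exists x in blobs D, pos x == p].

Lemma pos_lt x : pos x < n + n.
Proof. by case: x => k /=; have := ltn_ord k; lia. Qed.

Lemma pos_surj p : p < n + n -> exists x : pt n, p = pos x.
Proof.
move=> pn; have [lt|ge] := ltnP p n; first by exists (inl (Ordinal lt)).
have lt : p - n < n by lia.
by exists (inr (rev_ord (Ordinal lt))); rewrite /pos rev_ordK /=; lia.
Qed.

Lemma partner_pos D x : partner D (pos x) = pos (mate D x).
Proof.
rewrite /partner; case: pickP => [y /eqP/(@pos_inj n) -> //|/(_ x)].
by rewrite eqxx.
Qed.

Lemma blob_pos D x : blob_at D (pos x) = (x \in blobs D).
Proof.
apply/exists_inP/idP => [[y yB /eqP/(@pos_inj n) <- //]|xB].
by exists x.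
Qed.

Lemma partner_lt D p : p < n + n -> partner D p < n + n.
Proof. by move=> /pos_surj[x ->]; rewrite partner_pos pos_lt. Qed.

Lemma partnerK D p : p < n + n -> partner D (partner D p) = p.
Proof. by move=> /pos_surj[x ->]; rewrite !partner_pos mateK. Qed.

Lemma partner_neq D p : p < n + n -> partner D p != p.
Proof.
move=> /pos_surj[x ->]; rewrite partner_pos; apply: contra_neq (mate_neq D x).
exact: pos_inj.
Qed.

Lemma partner_nc D p q : p < q -> q < partner D p -> partner D p < partner D q ->
  p < n + n -> q < n + n -> False.
Proof.
move=> h1 h2 h3 /pos_surj[x px] /pos_surj[y qy]; move: h1 h2 h3.
rewrite px qy !partner_pos; exact: mate_nc.
Qed.

Lemma blob_partner D p : p < n + n -> blob_at D (partner D p) = blob_at D p.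
Proof.
move=> /pos_surj[x ->]; rewrite partner_pos !blob_pos.
by apply/idP/idP => /mate_blobs //; rewrite mateK.
Qed.

Lemma blob_exposed D p q : p < n + n -> q < n + n -> blob_at D p ->
  q < p -> p < partner D q -> False.
Proof.
move=> /pos_surj[x ->] /pos_surj[y ->]; rewrite partner_pos blob_pos => xB h1 h2.
by apply: (blobs_exposed xB (y := y)); rewrite h1.
Qed.

Lemma partner_eqP D E : (forall p, p < n + n -> partner D p = partner E p) ->
  (forall p, p < n + n -> blob_at D p = blob_at E p) -> D = E.
Proof.
move=> hm hb; apply: TL_eqP => x.
  by apply: pos_inj; rewrite -!partner_pos hm ?pos_lt.
by rewrite -!blob_pos hb ?pos_lt.
Qed.

Lemma partner_one p : p < n + n -> partner (TL_one n) p = (n + n) - p.+1.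
Proof.
move=> /pos_surj[x ->]; rewrite partner_pos /mate /= ffunE.
by case: x => k /=; have := ltn_ord k; lia.
Qed.

Lemma blob_one p : blob_at (TL_one n) p = false.
Proof. by apply/exists_inP => -[x]; rewrite inE. Qed.

Lemma partner_eq D p q : p < n + n -> q < n + n -> (partner D p == q) = (p == partner D q).
Proof. by move=> pn qn; apply/eqP/eqP => [<-|->]; rewrite partnerK. Qed.

(** Bottom points are ranked from right to left: [s] is the rank of [inr i] and [s.+1] that of
    [inr (ipred i)]. The additive equation for [s] avoids truncated subtraction. *)
Lemma partner_mul_cup D i s p : 0 < i -> s + i.+1 = n + n -> p < n + n ->
  partner (TL_mul D (TL_gen i)) p =
  if p == s then s.+1 else if p == s.+1 then s
  else if p == partner D s then partner D s.+1
  else if p == partner D s.+1 then partner D s else partner D p.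
Proof.
move=> i0 sE pn; rewrite -!partner_eq; try lia.
move: pn => /pos_surj[x ->]; rewrite !partner_pos mate_mul_cup // /cap_mate.
have sb : s = pos (inr i : pt n) by rewrite /=; have := ltn_ord i; lia.
have sa : s.+1 = pos (inr (ipred i) : pt n) by rewrite /=; have := ltn_ord i; lia.
rewrite sa sb !partner_pos !(inj_eq (@pos_inj n)).
by do 4?case: ifP.
Qed.

Lemma blob_mul_cup D i s p : 0 < i -> s + i.+1 = n + n -> p < n + n ->
  blob_at (TL_mul D (TL_gen i)) p =
  [&& p != s, p != s.+1 & [|| blob_at D p, (p == partner D s) && blob_at D s.+1
                            | (p == partner D s.+1) && blob_at D s]].
Proof.
move=> i0 sE pn; rewrite -!partner_eq; try lia.
move: pn => /pos_surj[x ->]; rewrite !partner_pos !blob_pos blobs_mul_cup // /cap_blobs.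
have sb : s = pos (inr i : pt n) by rewrite /=; have := ltn_ord i; lia.
have sa : s.+1 = pos (inr (ipred i) : pt n) by rewrite /=; have := ltn_ord i; lia.
by rewrite sa sb !blob_pos !(inj_eq (@pos_inj n)) andbCA.
Qed.

Lemma partner_mul_blob D i p : i = 0 :> nat ->
  partner (TL_mul D (TL_gen i)) p = partner D p.
Proof. by move=> i0; rewrite /partner; case: pickP => // x _;
  rewrite mate_mul_blob. Qed.

Lemma blob_mul_blob D i p : i = 0 :> nat -> p < n + n ->
  blob_at (TL_mul D (TL_gen i)) p =
  [|| blob_at D p, p == (n + n).-1 | partner D p == (n + n).-1].
Proof.
move=> i0 /pos_surj[x ->]; rewrite partner_pos !blob_pos blobs_mul_blob //.
have sb : (n + n).-1 = pos (inr i : pt n) by rewrite /=; have := ltn_ord i; lia.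
by rewrite sb !(inj_eq (@pos_inj n)).
Qed.

(** * The blob relations among diagrams *)

Ltac ifree t := lazymatch t with context [if _ then _ else _] => fail | _ => idtac end.
(** Tests whose sides contain no conditional go first; each is decided by arithmetic if possible,
    and by cases otherwise. *)
Ltac decide_eqs :=
  repeat match goal with
  | |- context [@eq_op ?T ?a ?b] => ifree a; ifree b;
    first [ rewrite (_ : (a == b) = true) /=; [|lia]
          | rewrite (_ : (a == b) = false) /=; [|lia]
          | case: (a =P b) => ? /= ]
  end; try lia; try done.

(** The generator is its product with the identity, so the multiplication formula applies; [q] is
    the rank opposite to [p] in the identity. *)
Lemma partner_gen i s p q : 0 < i -> s + i.+1 = n + n -> q + p.+1 = n + n ->
  partner (TL_gen i) p =
  if p == s then s.+1 else if p == s.+1 then s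
  else if p == i then i.-1 else if p.+1 == i then nat_of_ord i else q.
Proof.
have li := ltn_ord i; rewrite -(TL_mul1x (TL_gen i)) => i0 sE qE.
rewrite (partner_mul_cup _ i0 sE) ?partner_one; try lia.
have -> : n + n - s.+2 = i.-1 by lia.
have -> : n + n - s.+1 = i by lia.
have -> : n + n - p.+1 = q by lia.
by have -> : (p == i.-1) = (p.+1 == i) by lia.
Qed.

Lemma partner_gen0 i p q : i = 0 :> nat -> q + p.+1 = n + n -> partner (TL_gen i) p = q.
Proof.
move=> i0 qE; rewrite -(TL_mul1x (TL_gen i)) partner_mul_blob // partner_one; lia.
Qed.

Lemma blob_at_gen i p : p < n + n ->
  blob_at (TL_gen i) p = (i == 0 :> nat) && ((p == 0) || (p.+1 == n + n)).
Proof.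
have li := ltn_ord i; rewrite -(TL_mul1x (TL_gen i)) => pn.
have [i0|i0] := posnP i.
  by rewrite blob_mul_blob ?partner_one ?blob_one //; lia.
rewrite (@blob_mul_cup _ i (n + n - i.+1)) ?partner_one ?blob_one; try lia.
Qed.

(** For [i > 0] the generator already joins [s] and [s.+1], and multiplying again only closes a loop
    there and restores the arc. *)
Lemma TL_gen_idem i : TL_mul (TL_gen i) (TL_gen i) = TL_gen i.
Proof.
have li := ltn_ord i.
have [i0|i0] := posnP i.
  apply: partner_eqP => p pn; first by rewrite partner_mul_blob.
  have [q qE] : exists q, q + p.+1 = n + n by exists (n + n - p.+1); lia.
  rewrite blob_mul_blob // !blob_at_gen // (partner_gen0 i0 qE) i0 /=; lia.
have [s sE] : exists s, s + i.+1 = n + n by exists (n + n - i.+1); lia.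
have e1 : partner (TL_gen i) s = s.+1 by rewrite (@partner_gen i s s i) ?eqxx //; lia.
have e2 : partner (TL_gen i) s.+1 = s.
  by rewrite (@partner_gen i s s.+1 i.-1) ?eqxx // ?gtn_eqF //; lia.
apply: partner_eqP => p pn.
  rewrite (partner_mul_cup _ i0 sE) // e1 e2; case: eqP => [->|_] //.
  by case: eqP => [->|_].
by rewrite (blob_mul_cup _ i0 sE) // e1 e2 !blob_at_gen ?(gtn_eqF i0) ?andbF //; lia.
Qed.

Lemma TL_gen_comm i (j : 'I_n) : i.+1 < j ->
  TL_mul (TL_gen i) (TL_gen j) = TL_mul (TL_gen j) (TL_gen i).
Proof.
move=> ij; have li := ltn_ord i; have lj := ltn_ord j; have j0 : 0 < j by lia.
have [s sE] : exists s, s + j.+1 = n + n by exists (n + n - j.+1); lia.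
have [j' jE] : exists j', nat_of_ord j = j'.+1 by exists j.-1; lia.
have [i0|i0] := posnP i.
  have e1 : partner (TL_gen i) s = j by apply: partner_gen0 => //; lia.
  have e2 : partner (TL_gen i) s.+1 = j' by apply: partner_gen0 => //; lia.
  apply: partner_eqP => p pn;
    have [q qE] : exists q, q + p.+1 = n + n by exists (n + n - p.+1); lia.
    rewrite (partner_mul_blob _ _ i0) (partner_mul_cup (TL_gen i) j0 sE) //.
    rewrite (partner_gen j0 sE qE) e1 e2 (partner_gen0 i0 qE).
    rewrite jE eqSS; decide_eqs.
  rewrite (blob_mul_blob _ i0) // (blob_mul_cup (TL_gen i) j0 sE) // e1 e2.
  rewrite (partner_gen j0 sE qE) !blob_at_gen; try lia.
  rewrite i0 jE /= eqSS; decide_eqs.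
have [r rE] : exists r, r + i.+1 = n + n by exists (n + n - i.+1); lia.
have [i' iE] : exists j', nat_of_ord i = j'.+1 by exists i.-1; lia.
have sr : s.+1 < r by lia.
have e1 : partner (TL_gen i) s = j.
  by rewrite (@partner_gen i r s j) //; decide_eqs.
have e2 : partner (TL_gen i) s.+1 = j'.
  by rewrite (@partner_gen i r s.+1 j') //; decide_eqs.
have e3 : partner (TL_gen j) r = i.
  by rewrite (@partner_gen j s r i) //; decide_eqs.
have e4 : partner (TL_gen j) r.+1 = i'.
  by rewrite (@partner_gen j s r.+1 i') //; decide_eqs.
apply: partner_eqP => p pn;
  have [q qE] : exists q, q + p.+1 = n + n by exists (n + n - p.+1); lia.
  rewrite (partner_mul_cup (TL_gen i) j0 sE) // (partner_mul_cup (TL_gen j) i0 rE) //.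
  rewrite e1 e2 e3 e4.
  rewrite (partner_gen i0 rE qE) (partner_gen j0 sE qE) iE jE /= !eqSS.
  decide_eqs.
rewrite (blob_mul_cup (TL_gen i) j0 sE) // (blob_mul_cup (TL_gen j) i0 rE) // e1 e2 e3 e4.
by rewrite !blob_at_gen ?(gtn_eqF i0) ?(gtn_eqF j0) /= ?andbF //; lia.
Qed.

(** The middle factor puts its blob on the arc from [s] to [s.+1], the last rank; the final factor
    closes this arc into a loop, which disappears with its blob. *)
Lemma TL_gen_101 i (j : 'I_n) : i = 0 :> nat -> j = 1 :> nat ->
  TL_mul (TL_mul (TL_gen j) (TL_gen i)) (TL_gen j) = TL_gen j.
Proof.
move=> i0 j1; have lj := ltn_ord j; have j0 : 0 < j by lia.
have [s sE] : exists s, s + j.+1 = n + n by exists (n + n - j.+1); lia.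
have e1 : partner (TL_gen j) s = s.+1 by rewrite (@partner_gen j s s j) ?eqxx //; lia.
have e2 : partner (TL_gen j) s.+1 = s.
  by rewrite (@partner_gen j s s.+1 j.-1) ?eqxx // ?gtn_eqF //; lia.
apply: partner_eqP => p pn.
  rewrite (partner_mul_cup (TL_mul (TL_gen j) (TL_gen i)) j0 sE) //.
  rewrite !(partner_mul_blob (TL_gen j) _ i0) e1 e2.
  by case: eqP => [->|_] //; case: eqP => [->|_].
rewrite (blob_mul_cup (TL_mul (TL_gen j) (TL_gen i)) j0 sE) //.
rewrite !(partner_mul_blob (TL_gen j) _ i0) e1 e2.
rewrite !(blob_mul_blob (TL_gen j) i0) ?e1 ?e2 ?partner_eq ?blob_at_gen; try lia.
have -> : (n + n).-1 = s.+1 by lia.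
rewrite e2 (gtn_eqF j0) /=; decide_eqs.
Qed.

(** The middle factor displaces the short arc on [r] and [r.+1] by one rank, to the left or right
    according to the order of [i] and [j]; the last factor puts it back. *)
Lemma TL_gen_braid i (j : 'I_n) : (i.+1 == j) || (j.+1 == i) ->
  i != 0 :> nat -> j != 0 :> nat ->
  TL_mul (TL_mul (TL_gen i) (TL_gen j)) (TL_gen i) = TL_gen i.
Proof.
move=> ij; rewrite -!lt0n => i0 j0; have li := ltn_ord i; have lj := ltn_ord j.
have [s sE] : exists s, s + j.+1 = n + n by exists (n + n - j.+1); lia.
have [j' jE] : exists j', nat_of_ord j = j'.+1 by exists j.-1; lia.
have [r rE] : exists r, r + i.+1 = n + n by exists (n + n - i.+1); lia.
set D := TL_gen i; set D2 := TL_mul D (TL_gen j).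
have e1 : partner D r = r.+1 by rewrite (@partner_gen i r r i) ?eqxx //; lia.
have e2 : partner D r.+1 = r.
  by rewrite (@partner_gen i r r.+1 i.-1) ?eqxx // ?gtn_eqF //; lia.
have bD p : p < n + n -> blob_at D p = false.
  by move=> pn; rewrite blob_at_gen // (gtn_eqF i0).
have bD2 p : p < n + n -> blob_at D2 p = false.
  by move=> pn; rewrite (blob_mul_cup D j0 sE) // !bD ?andbF //; lia.
apply: partner_eqP => p pn; last first.
  by rewrite (blob_mul_cup D2 i0 rE) // !bD2 ?bD ?andbF //; lia.
rewrite (partner_mul_cup D2 i0 rE) //.
have rn : r < n + n by lia.
have rn' : r.+1 < n + n by lia.
case/orP: ij => /eqP ij.
  have rs : r = s.+1 by lia.
  have e3 : partner D s = j by rewrite (@partner_gen i r s j) //; decide_eqs.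
  have e4 : partner D j = s by rewrite -e3 partnerK //; lia.
  have m u (un : u < n + n) := partner_mul_cup D j0 sE un; rewrite -/D2 in m.
  have f1 : partner D2 r = s by rewrite (m _ rn) e3 -?rs ?e1; decide_eqs.
  have f2 : partner D2 r.+1 = j by rewrite (m _ rn') e3 -?rs ?e1 ?e2; decide_eqs.
  rewrite f1 f2 (m _ pn) e3 -rs e1.
  case: (p =P r) => [->|?] //; case: (p =P r.+1) => [->|?] //.
  by case: (p =P s) => [->|?] //; case: (p =P j :> nat) => [->|?].
have rs : s = r.+1 by lia.
have e3 : partner D s.+1 = j' by rewrite (@partner_gen i r s.+1 j') //; decide_eqs.
have e4 : partner D j' = s.+1 by rewrite -e3 partnerK //; lia.
have m u (un : u < n + n) := partner_mul_cup D j0 sE un; rewrite -/D2 in m.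
have f1 : partner D2 r = j' by rewrite (m _ rn) e3 rs ?e1 ?e2; decide_eqs.
have f2 : partner D2 r.+1 = s.+1 by rewrite (m _ rn') e3 rs ?e1 ?e2; decide_eqs.
rewrite f1 f2 (m _ pn) e3 rs e2 -rs.
case: (p =P r) => [->|?]; first by rewrite e1.
case: (p =P s) => [->|?]; first by rewrite rs e2.
by case: (p =P j') => [->|?] //; case: (p =P s.+1) => [->|?].
Qed.

End Positions.

Local Open Scope group_scope.

(** * Normal forms *)

Section NormalForms.
Variables (M : monoidType) (g : nat -> M).

(* [block a k] is [g a.-1 * ... * g k], so the bound [a] is excluded. *)
Fixpoint block (a k : nat) : M :=
  if a is a'.+1 then if k <= a' then g a' * block a' k else 1 else 1.

Lemma block_nil a k : a <= k -> block a k = 1.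
Proof. by case: a => //= a ak; rewrite leqNgt ak. Qed.

Lemma blockS a k : k <= a -> block a.+1 k = g a * block a k.
Proof. by move=> /= ->. Qed.

Lemma block_cat a b k : k <= b <= a -> block a b * block b k = block a k.
Proof.
elim: a => [|a IH] /andP[kb ba]; first by case: b ba {kb} => // _; apply: mul1g.
have [->|ne] := eqVneq b a.+1; first by rewrite block_nil // mul1g.
by rewrite !blockS; try lia; rewrite -mulgA IH //; lia.
Qed.

Lemma block1 a : block a.+1 a = g a.
Proof. by rewrite blockS // block_nil // mulg1. Qed.

Inductive generated (N : nat) : M -> Prop :=
| generated_one : generated N 1
| generated_mul i x : i < N -> generated N x -> generated N (g i * x).

Lemma generatedW N N' x : N <= N' -> generated N x -> generated N' x.
Proof.
move=> le; elim=> [|i y iN _ IH]; first exact: generated_one.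
by apply: generated_mul => //; apply: leq_trans le.
Qed.

Lemma generatedM N x y : generated N x -> generated N y -> generated N (x * y).
Proof.
move=> gx gy; elim: gx => [|i z iN _ IH]; first by rewrite mul1g.
by rewrite -mulgA; apply: generated_mul.
Qed.

Lemma generated_block a k : generated a (block a k).
Proof.
elim: a => [|a IH] /=; first exact: generated_one.
case: ifP => _; last exact: generated_one.
by apply: generated_mul => //; apply: generatedW IH.
Qed.

(* A letter [(o, b)] describes an endpoint of an arc, in the order of ranks: [o]
   says that it is the first one of the arc, and [b] that the arc has a blob. *)
Definition insert_arc (p : nat) (b : bool) (f : nat -> bool * bool) (q : nat) :=
  if q < p then f q else if q == p then (true, b)
  else if q == p.+1 then (false, b) else f q.-2.

(* Here [f] only matters below [2 * N]. On diagrams, multiplying by a block inserts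
   a short arc; the condition on [f] makes it the last short arc of the result, so
   that it can be read off from [f']. *)
Inductive normal_form : nat -> M -> (nat -> bool * bool) -> Prop :=
| normal_one f : normal_form 0 1 f
| normal_cup N x f p f' : normal_form N x f -> N <= p <= N + N ->
    (forall q, p <= q < N + N -> (f q).1 = false) ->
    (forall q, q < (N + N).+2 -> f' q = insert_arc p false f q) ->
    normal_form N.+1 (x * block N.+1 ((N + N).+1 - p)) f'
| normal_blob N x f f' : normal_form N x f ->
    (forall q, q < (N + N).+2 -> f' q = insert_arc (N + N) true f q) ->
    normal_form N.+1 (x * block N.+1 0) f'.

(** Both ways of adding an arc take one shape, with [b] telling whether the arc has a blob, so that
    later arguments treat them together. *)
Lemma normal_form_inv N x f : normal_form N x f ->
  match N with
  | 0 => x = 1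
  | N.+1 => exists y k f1 p b,
     [/\ normal_form N y f1, x = y * block N.+1 k,
         forall q, q < (N + N).+2 -> f q = insert_arc p b f1 q,
         forall q, p <= q < N + N -> (f1 q).1 = false &
         if b then k = 0 /\ p = N + N else k = (N + N).+1 - p /\ N <= p <= N + N]
  end.
Proof.
case=> // {}N {}x {}f => [p f' nf hp hc hf|f' nf hf].
  by exists x, ((N + N).+1 - p), f, p, false.
by exists x, 0, f, (N + N), true; split=> // q; lia.
Qed.

(** The last inserted arc sits at the last opening letter, whose flag tells if it has a blob. Its
    block is thus read off the word, and removing the arc gives the induction. *)
Lemma normal_form_inj N x x' f f' :
  normal_form N x f -> normal_form N x' f' ->
  (forall q, q < N + N -> f q = f' q) -> x = x'.
Proof.
elim: N x x' f f' => [|N IH] x x' f f' /normal_form_inv h /normal_form_inv h' ff.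
  by rewrite h h'.
case: h => [y [k [f1 [p [b [nf -> hf hc hb]]]]]].
case: h' => [y' [k' [f1' [p' [b' [nf' -> hf' hc' hb']]]]]].
have pN : p <= N + N by case: (b) hb; lia.
have pN' : p' <= N + N by case: (b') hb'; lia.
have e q : q < (N + N).+2 -> insert_arc p b f1 q = insert_arc p' b' f1' q.
  by move=> qN; rewrite -hf // -hf' // ff //; lia.
(* If the positions differed, the larger one would carry an opening letter in one word and a closing
   letter in the other. *)
have pp : p = p'.
  case: (ltngtP p p') => // lt.
    have := e p'; rewrite /insert_arc ltnn eqxx [p' < p]ltnNge (ltnW lt) gtn_eqF //=.
    case: eqP => [_|ne] /(_ ltac:(lia)) h; first by case: h.
    by have := hc p'.-2; rewrite h /= => /(_ ltac:(lia)).
  have := e p; rewrite /insert_arc ltnn eqxx [p < p']ltnNge (ltnW lt) gtn_eqF //=.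
  case: eqP => [_|ne] /(_ ltac:(lia)) h; first by case: h.
  by have := hc' p.-2; rewrite -h /= => /(_ ltac:(lia)).
have bb : b = b' by have := e p; rewrite /insert_arc pp ltnn eqxx => /(_ ltac:(lia)) [].
have -> : k = k' by move: hb hb'; rewrite -bb -pp; case: (b) => -[-> _] [-> _].
congr (_ * _); apply: IH nf nf' _ => q qN.
have [lt|ge] := ltnP q p.
  by have := e q; rewrite /insert_arc -pp lt => /(_ ltac:(lia)).
have := e q.+2; rewrite /insert_arc -pp.
have -> : (q.+2 < p) = false by lia.
have -> : (q.+2 == p) = false by lia.
have -> : (q.+2 == p.+1) = false by lia.
by move=> /(_ ltac:(lia)).
Qed.

(** The shift by two is the width of the arc inserted on the left. *)
Lemma insert_arc_comm p p' b b' f q : p <= p' ->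
  insert_arc p b (insert_arc p' b' f) q = insert_arc p'.+2 b' (insert_arc p b f) q.
Proof.
move=> pp; rewrite /insert_arc.
case: (ltngtP q p) => h1; first by rewrite !ifT //; lia.
- case: (q =P p.+1) => h2; first by rewrite ifT //; lia.
  have -> : (q < p'.+2) = (q.-2 < p') by lia.
  have -> : (q == p'.+2) = (q.-2 == p') by lia.
  have -> : (q == p'.+3) = (q.-2 == p'.+1) by lia.
  case: ifP => // h3; case: ifP => // h4; case: ifP => // h5.
  by rewrite !ifF //; lia.
- by rewrite ifT //; lia.
Qed.

Lemma eq_insert_arc m p b f f' q : (forall q, q < m -> f q = f' q) ->
  p <= m -> q < m.+2 -> insert_arc p b f q = insert_arc p b f' q.
Proof.
move=> ff pm qm; rewrite /insert_arc; case: ltngtP => // qp; first by rewrite ff //;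
  lia.
by case: eqP => // ne; rewrite ff //; lia.
Qed.

(** * Reduction to normal form by the blob relations *)

Variable n : nat.
Hypothesis g_idem : forall i, i < n -> g i * g i = g i.
Hypothesis g_comm : forall i j, i.+1 < j -> j < n -> g i * g j = g j * g i.
Hypothesis g_101 : 1 < n -> g 1 * g 0 * g 1 = g 1.
Hypothesis g_braid : forall i, i.+2 < n ->
  g i.+1 * g i.+2 * g i.+1 = g i.+1 /\ g i.+2 * g i.+1 * g i.+2 = g i.+2.

(** The block has letters of index [k] to [a.-1], so either alternative keeps [i] at distance at
    least two from all of them. *)
Lemma block_comm i a k : (i.+1 < k) && (a <= n) || (a < i) && (i < n) ->
  commute (g i) (block a k).
Proof.
move=> h; elim: a h => [|a IH] h; first exact: commute1.
rewrite /=; case: ifP => ka; last exact: commute1.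
apply: commuteM; last by apply: IH; lia.
by case/orP: h => h; [apply: g_comm|apply/esym/g_comm]; lia.
Qed.

Lemma block_comm2 a k b j : b < k -> a <= n -> commute (block b j) (block a k).
Proof.
move=> bk an; elim: b bk => [|b IH] bk; first exact/commute_sym/commute1.
rewrite /=; case: ifP => jb; last exact/commute_sym/commute1.
apply/commute_sym/commuteM; apply: commute_sym; last by apply: IH; lia.
by apply: block_comm; lia.
Qed.

(** Once the blocks are split at [c.+1] and the common prefix is cancelled, [block N.+1 c.+2]
    commutes with all letters of index at most [c], and the right side keeps [g c * g c.+1 * g c],
    which shrinks to [g c] because [0 < c]. *)
Lemma block_swap N k c : k <= c -> 0 < c < N -> N < n ->
  block N k * block N.+1 c.+2 = block N c * block N.+1 k.
Proof.
move=> kc /andP[c0 cN] Nn.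
rewrite -(@block_cat N c.+1 k) -?(@block_cat N c.+1 c) -?(@block_cat N.+1 c.+1 k);
  try lia.
rewrite -(@block_cat N.+1 c.+2 c.+1) ?block1; try lia.
rewrite (blockS kc) -!mulgA; congr (_ * _).
have h : commute (g c) (block N.+1 c.+2) by apply: block_comm; lia.
rewrite [RHS]mulgA h -!mulgA.
case: c c0 cN {h} kc => // c _ cN kc.
have -> y : g c.+1 * (g c.+2 * (g c.+1 * y)) = g c.+1 * y.
  by rewrite !mulgA; case: (@g_braid c) => [|-> _] //; lia.
have h1 : commute (g c.+1) (block N.+1 c.+3) by apply: block_comm; lia.
have h2 : commute (block c.+1 k) (block N.+1 c.+3) by apply: block_comm2; lia.
by rewrite h2 mulgA h1 mulgA.
Qed.

Lemma generated_comm N x i : generated N x -> N < i < n -> commute (g i) x.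
Proof.
move=> gx h; elim: gx => [|j y jN _ IH]; first exact: commute1.
by apply: commuteM => //; apply/esym/g_comm; lia.
Qed.

(** The leading [g N] of the second block moves left through the tail of the first until it meets
    [g N * g N.-1], where two letters cancel. For [N = 1] this uses [g_101]. *)
Lemma block_block N k k' : 0 < N < n -> k <= N -> k' < N ->
  block N.+1 k' * block N.+1 k = block N.-1 k' * block N.+1 k.
Proof.
case: N => // N; rewrite ltnS -pred_Sn => Nn kN k'N.
rewrite !(@blockS N.+1) ?(@blockS N k'); try lia.
have h : commute (g N.+1) (block N k') by apply: block_comm; lia.
rewrite -!mulgA (mulgA (block N k')) -h !mulgA.
suff -> : g N.+1 * g N * g N.+1 = g N.+1 by rewrite h.
by case: N Nn {kN k'N h} => [|N] Nn; [apply: g_101|case: (@g_braid N Nn)].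
Qed.

(* At most one occurrence of the generator of largest index is needed. *)
Lemma generated_split N x : N < n -> generated N.+1 x ->
  exists y k, [/\ generated N y, k <= N.+1 & x = y * block N.+1 k].
Proof.
elim: N x => [|N IH] x Nn; elim=> [|i z iN _ [y [k [gy kN ->]]]].
- by exists 1, 1%N; split; rewrite ?block_nil ?mulg1 //; apply: generated_one.
- exists 1, 0%N; split=> //; first exact: generated_one.
  have -> : i = 0 by lia.
  have -> : y = 1 by case: gy.
  rewrite !mul1g block1; case: k kN => [|k] kN; first by rewrite block1 g_idem.
  by rewrite block_nil // mulg1.
- by exists 1, N.+2; split; rewrite ?block_nil ?mulg1 //; apply: generated_one.
have [iN'|iN'] := ltnP i N.+1.
  by exists (g i * y), k; split; rewrite ?mulgA //; apply: generated_mul.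
have {iN iN'} -> : i = N.+1 by lia.
(* Splitting [y] in turn lets [g N.+1] pass [y'] and join the block behind it, which leaves two
   blocks starting with [g N.+1]. *)
have [y' [k' [gy' k'N ->]]] := IH y (ltnW Nn) gy.
have h : commute (g N.+1) y' by apply: generated_comm gy' _; lia.
have gy'' := generatedW (leqnSn N) gy'.
have e : g N.+1 * block N.+1 k' = block N.+2 k' by rewrite (blockS k'N).
rewrite !mulgA h -(mulgA y') e.
(* The second block may be empty, or the first may be the single letter [g N.+1], absorbed by
   idempotence; otherwise [block_block] shortens the first. *)
have [->|kN'] := eqVneq k N.+2.
  by exists y', k'; split=> //; [lia|rewrite (@block_nil N.+2 N.+2) ?mulg1].
have kN1 : k <= N.+1 by lia.
have [->|k'N'] := eqVneq k' N.+1.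
  exists y', k; split=> //.
  by rewrite block1 (blockS kN1) -!mulgA (mulgA (g _)) g_idem.
exists (y' * block N k'), k; split; first 1 last; first lia.
  by rewrite -!mulgA block_block //; lia.
apply: generatedM gy'' _; apply: generatedW (generated_block _ _); lia.
Qed.

(** To the right of the last insertion [p1] the new arc is already in order. Otherwise the two
    insertions are exchanged, by [block_swap] on elements and [insert_arc_comm] on words, and
    induction inserts the new arc one level down. *)
Lemma normal_form_insert N x f p : N < n -> N <= p <= N + N ->
  normal_form N x f ->
  normal_form N.+1 (x * block N.+1 ((N + N).+1 - p)) (insert_arc p false f).
Proof.
elim: N x f p => [|N IH] x f p Nn hp nf.
  by apply: normal_cup (nf) _ _ _ => // q; lia.
have := normal_form_inv nf; case=> [y [k [f1 [p1 [b [nf1 xE hf hc hb]]]]]].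
have fc q : p1 < q < (N + N).+2 -> (f q).1 = false.
  move=> /andP[q1 q2]; rewrite hf // /insert_arc ltnNge (ltnW q1) gtn_eqF //=.
  by case: eqP => // ne; apply: hc; lia.
have [lt|ge] := ltnP p1 p.
  by apply: normal_cup (nf) _ _ _ => // q; rewrite addSn addnS => /andP[h1 h2];
    apply: fc; lia.
have [p1N kN] : p1 <= N + N /\ k <= N.+1 by case: (b) hb; lia.
have IH' : normal_form N.+1 (y * block N.+1 ((N + N).+1 - p)) (insert_arc p false f1).
  by apply: IH nf1; lia.
(* [block_swap] is used with [c = (N + N).+1 - p]: here [p <= p1 <= N + N] gives [0 < c], and
   [N < p] gives [c < N.+1]. *)
have sw : x * block N.+2 ((N.+1 + N.+1).+1 - p) =
    y * block N.+1 ((N + N).+1 - p) * block N.+2 k.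
  have -> : (N.+1 + N.+1).+1 - p = ((N + N).+1 - p).+2 by lia.
  rewrite xE -!mulgA; congr (_ * _); apply: block_swap; try lia.
  by case: (b) hb; lia.
have ff q : q < (N.+1 + N.+1).+2 ->
    insert_arc p false f q = insert_arc p1.+2 b (insert_arc p false f1) q.
  move=> qN; rewrite -insert_arc_comm //; apply: eq_insert_arc qN; last lia.
  by move=> r rN; apply: hf; lia.
rewrite sw; case: b hb {hf} ff => -[kE pE] ff.
  rewrite kE; apply: normal_blob IH' _ => q qN; rewrite ff //.
  by rewrite pE addSn addnS.
have -> : k = (N.+1 + N.+1).+1 - p1.+2 by lia.
apply: normal_cup IH' _ _ ff => [|q hq]; first lia.
by rewrite /insert_arc !ifF; try lia; apply: hc; lia.
Qed.

(** The last block is split off. If it ends in [g 0], its arc belongs at the end of the word and is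
    already in order; any other block is sorted in. *)
Lemma generated_normal_form N x : N <= n -> generated N x ->
  exists f, normal_form N x f.
Proof.
elim: N x => [|N IH] x Nn gx.
  exists (fun=> (true, true)); have -> : x = 1 by case: gx.
  exact: normal_one.
have [y [k [gy kN ->]]] := generated_split Nn gx.
have [f nf] := IH y (ltnW Nn) gy.
have [->|k0] := posnP k; first by eexists; apply: normal_blob nf _.
have -> : k = (N + N).+1 - ((N + N).+1 - k) by lia.
by eexists; apply: normal_form_insert nf => //; lia.
Qed.

End NormalForms.

(** * Letters of a diagram *)

Section Letters.
Variable n : nat.
Implicit Types D E X Y : blobbed_TL n.

Definition letter D p := (p < partner D p, blob_at D p).

(** If an opening endpoint [p] has different partners, the nearer one is joined in the other diagram
    to some [z] strictly between. This [z] opens a shorter arc of [D], so induction on arc length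
    gives a contradiction. *)
Lemma letter_inj D E : (forall p, p < n + n -> letter D p = letter E p) -> D = E.
Proof.
move=> h; have hb p : p < n + n -> blob_at D p = blob_at E p by move=> /h [].
have ho p : p < n + n -> (p < partner D p) = (p < partner E p) by move=> /h [].
have opener m p : partner D p - p < m -> p < n + n -> p < partner D p ->
    partner D p = partner E p.
  elim: m p => // m IH p lm pn po.
  have po' : p < partner E p by rewrite -ho.
  have [yn yn'] : partner D p < n + n /\ partner E p < n + n by rewrite !partner_lt.
  case: (ltngtP (partner D p) (partner E p)) => // lt; exfalso.
    set z := partner E (partner D p).
    have zn : z < n + n by apply: partner_lt.
    have Ez : partner E z = partner D p by apply: partnerK.
    have zy : z < partner D p.
      have := ho _ yn; rewrite partnerK // ltnNge (ltnW po) => /esym/negbT.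
      by rewrite -leqNgt leq_eqVlt => /orP[/eqP e|//]; have := partner_neq E yn;
        rewrite e eqxx.
    have pz : p < z.
      case: (ltngtP z p) => // [zp|e]; first by case: (partner_nc zp (D := E)) => //;
        rewrite Ez.
      by rewrite e in Ez; rewrite Ez ltnn in lt.
    have zo : z < partner D z by rewrite ho // Ez.
    have zD : partner D z < partner D p.
      case: (ltngtP (partner D z) (partner D p)) => // [gt|e];
        first by case: (partner_nc pz zy gt).
      by have := partnerK D zn; rewrite e partnerK // => e'; rewrite e' ltnn in pz.
    by have := IH z; rewrite Ez => /(_ ltac:(lia) zn zo) e; rewrite e ltnn in zD.
  set z := partner D (partner E p).
  have zn : z < n + n by apply: partner_lt.
  have Dz : partner D z = partner E p by apply: partnerK.
  have zy : z < partner E p.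
    have := ho _ yn'; rewrite partnerK // [RHS]ltnNge (ltnW po') => /negbT.
    by rewrite -leqNgt leq_eqVlt => /orP[/eqP e|//]; have := partner_neq D yn';
      rewrite e eqxx.
  have pz : p < z.
    case: (ltngtP z p) => // [zp|e]; first by case: (partner_nc zp (D := D)) => //;
      rewrite Dz.
    by rewrite e in Dz; rewrite Dz ltnn in lt.
  have := IH z; rewrite Dz => /(_ ltac:(lia) zn zy) e.
  by have := partnerK E zn; rewrite -e partnerK // => e'; rewrite e' ltnn in pz.
apply: partner_eqP => // p pn; case: (ltngtP p (partner D p)) => po.
- exact: (opener _ _ (ltnSn _)).
- have qn := partner_lt D pn.
  have := opener _ (partner D p) (ltnSn _) qn; rewrite partnerK // => /(_ po) e.
  by rewrite {2}e partnerK.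
- by have := partner_neq D pn; rewrite -po eqxx.
Qed.

(* The condition on [p] selects the ranks of the points after the first [N] strands. *)
Definition straight N D := forall p, N <= p -> p + N < n + n ->
  partner D p = n + n - p.+1 /\ blob_at D p = false.

(* The [q]-th endpoint among those of the first [N] strands. *)
Definition rank N q := if q < N then q else q + (n + n) - (N + N).

(** The invariant kept while the letters of a block are multiplied one by one. *)
Definition short_arc N D p (f : nat -> bool * bool) b :=
  [/\ straight N.+1 D, partner D (rank N.+1 p) = rank N.+1 p.+1 &
      forall q, q < (N + N).+2 -> letter D (rank N.+1 q) = insert_arc p b f q].

(** Before any letter of the block, the short arc is the straight strand of index [N], whose ends
    are neighbours among the endpoints of the first [N.+1] strands. *)
Lemma short_arc_straight N D f : N < n -> straight N D ->
  (forall q, q < N + N -> letter D (rank N q) = f q) -> short_arc N D N f false.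
Proof.
move=> Nn sD hf; split=> [p h1 h2||q qN]; first by apply: sD; lia.
  by rewrite /rank ltnn ltnSn; have [-> _] := sD N ltac:(lia) ltac:(lia); lia.
rewrite /insert_arc; case: ltngtP => qN'.
- by rewrite -hf; [congr letter; rewrite /rank !ifT; lia|lia].
- case: eqP => [->|ne].
    have -> : rank N.+1 N.+1 = n + n - N.+1 by rewrite /rank ltnn; lia.
    have [e1 e2] := sD (n + n - N.+1) ltac:(lia) ltac:(lia).
    by rewrite /letter e1 e2; congr pair; lia.
  rewrite -hf; last lia.
  by congr letter; rewrite /rank !ifF; lia.
- have -> : rank N.+1 q = N by rewrite /rank qN' ltnSn.
  have [e1 e2] := sD N ltac:(lia) ltac:(lia).
  by rewrite /letter e1 e2; congr pair; lia.
Qed.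

(** The generator links the right end [s] of the short arc to the next endpoint [s.+1]. So the left
    end [x] takes over the arc and letter of [s.+1], and a new short arc appears one place
    further. *)
Lemma short_arc_slide N D d f (i : 'I_n) : N < n -> d < N ->
  short_arc N D (N + d) f false -> i + d = N ->
  short_arc N (TL_mul D (TL_gen i)) (N + d.+1) f false.
Proof.
move=> Nn dN [sD aD hf] iN; have i0 : 0 < i by lia.
have [s sE] : exists s, s + i.+1 = n + n by exists (n + n - i.+1); lia.
set x := rank N.+1 (N + d).
have x1 : rank N.+1 (N + d).+1 = s by rewrite /rank ifF; lia.
have x2 : rank N.+1 (N + d).+2 = s.+1 by rewrite /rank ifF; lia.
have xs : x < s by rewrite /x /rank; case: ifP; lia.
(* For [d = 0] the short arc goes from top to bottom, its ranks possibly far apart; afterwards it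
   lies on the bottom, with consecutive ranks. *)
have xsN : (x = N /\ d = 0) \/ (x.+1 = s /\ 0 < d).
  by rewrite /x /rank; case: ifP; lia.
have sn : s.+1 < n + n by lia.
have snn : s < n + n by lia.
have xn : x < n + n by lia.
have ax : partner D x = s by rewrite aD x1.
have as_ : partner D s = x by rewrite -ax partnerK.
set z := partner D s.+1.
have zn : z < n + n by apply: partner_lt.
have az : partner D z = s.+1 by apply: partnerK.
have zx : z != x by apply/eqP => e; move: az; rewrite e ax; lia.
have zs : z != s by apply/eqP => e; move: az; rewrite e as_; lia.
have zs1 : z != s.+1 by apply: partner_neq.
(* By noncrossing, [x] and [s.+1] lie on the same side of [z], so the opening flag survives the move
   from [s.+1] to [x]. *)
have zout : (z < x) || (s.+1 < z).
  case: (ltngtP z x) zx => //= xz _; case: (ltngtP z s.+1) zs1 => //= zs' _.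
  by case: (partner_nc xz _ _ xn zn (D := D)); rewrite ?ax ?az //; lia.
have bs : blob_at D s = false.
  have := hf (N + d).+1 ltac:(lia); rewrite x1 /insert_arc.
  by rewrite ltnNge leqnSn gtn_eqF //= eqxx => -[].
have bx : blob_at D x = false by rewrite -(blob_partner D xn) ax.
have am p : p < n + n -> partner (TL_mul D (TL_gen i)) p =
    if p == s then s.+1 else if p == s.+1 then s
    else if p == x then z else if p == z then x else partner D p.
  by move=> pn; rewrite (partner_mul_cup D i0 sE) // as_.
have bm p : p < n + n -> blob_at (TL_mul D (TL_gen i)) p =
    [&& p != s, p != s.+1 & (blob_at D p || (p == x) && blob_at D s.+1)].
  by move=> pn; rewrite (blob_mul_cup D i0 sE) // as_ bs andbF orbF.
have far p : p < n + n -> p != s -> p != s.+1 -> p != x ->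
    letter (TL_mul D (TL_gen i)) p = letter D p.
  move=> pn ps ps1 px;
    rewrite /letter am // bm // (negbTE ps) (negbTE ps1) (negbTE px) /= orbF.
  by case: eqP => // ->; rewrite az; congr pair; lia.
split.
- move=> p h1 h2; have pn : p < n + n by lia.
  have [e1 e2] := sD p h1 h2.
  have ps : (p == s) = false by lia.
  have ps1 : (p == s.+1) = false by lia.
  have px : (p == x) = false by lia.
  rewrite am // bm // ps ps1 px /= orbF; split=> //.
  by case: eqP => // e; move: az; rewrite -e e1; lia.
- by rewrite addnS x1 x2 am // eqxx.
move=> q qN; have h := hf q qN; rewrite addnS.
have rq : rank N.+1 q < n + n by rewrite /rank; case: ifP; lia.
have [q1|q1] := ltnP q (N + d).
  have rx : rank N.+1 q < x by rewrite /x /rank; do 2!case: ifP; lia.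
  rewrite far //; try lia.
  by rewrite h /insert_arc !ifT //; lia.
have [q3|q3] := ltnP (N + d).+2 q.
  have rx : s.+1 < rank N.+1 q by rewrite -x2 /rank; do 2!case: ifP; lia.
  rewrite far //; try lia.
  by rewrite h /insert_arc !ifF //; lia.
have [q0|q0] := eqVneq q (N + d).
  have h2 := hf (N + d).+2 ltac:(lia); rewrite x2 /insert_arc !ifF in h2; try lia.
  rewrite q0 -/x /insert_arc ltnSn -[f _]h2 /letter am // bm // eqxx bx /=.
  have -> : (x == s) = false by lia.
  have -> : (x == s.+1) = false by lia.
  by rewrite /= -/z; congr pair; lia.
have [->|q2] := eqVneq q (N + d).+1.
  by rewrite x1 /insert_arc ltnn eqxx /letter am // bm // eqxx ltnSn.
have -> : q = (N + d).+2 by lia.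
rewrite x2 /insert_arc ltnNge leqnSn eqxx /= gtn_eqF // /letter am // bm // eqxx.
by rewrite gtn_eqF // andbF ltnNge leqnSn.
Qed.

(** The generator of index 0 marks the arc through the last rank, and at position [N + N] that is
    the short arc. *)
Lemma short_arc_blob N D f (i : 'I_n) : N < n -> i = 0 :> nat ->
  short_arc N D (N + N) f false -> short_arc N (TL_mul D (TL_gen i)) (N + N) f true.
Proof.
move=> Nn i0 [sD aD hf].
have last_rank : rank N.+1 (N + N).+1 = (n + n).-1.
  by rewrite /rank ifF; lia.
have rn q : q < (N + N).+2 -> rank N.+1 q < n + n by rewrite /rank; case: ifP; lia.
split=> [p h1 h2||q qN]; rewrite ?partner_mul_blob //.
  have [e1 e2] := sD p h1 h2.
  rewrite (blob_mul_blob D i0) ?e1 ?e2; [by split=> //; lia|lia].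
have h := hf q qN; have rqn := rn _ qN.
rewrite /letter partner_mul_blob // blob_mul_blob //.
have an : (n + n).-1 < n + n by lia.
have al : partner D (n + n).-1 = rank N.+1 (N + N).
  by rewrite -last_rank -aD partnerK // rn.
rewrite partner_eq // al.
have rinj r : r < (N + N).+2 -> (rank N.+1 q == rank N.+1 r) = (q == r).
  by move=> rN; rewrite /rank; do 2!case: ifP; lia.
rewrite -last_rank !rinj //.
have [-> ->] : rank N.+1 q < partner D (rank N.+1 q) = (insert_arc (N + N) false f q).1
  /\ blob_at D (rank N.+1 q) = (insert_arc (N + N) false f q).2 by rewrite -h.
rewrite /insert_arc.
case: (ltngtP q (N + N)) => h1; rewrite ?orbT ?orbF //=.
- have -> : (q == (N + N).+1) = false by lia.
  by rewrite orbF; case: (f q).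
- have -> : q = (N + N).+1 by lia.
  by rewrite eqxx orbT.
Qed.

Section NormalFormLetters.
Variable g : nat -> blobbed_TL n.
Hypothesis gE : forall i : 'I_n, g i = TL_gen i.

(** The block has [d] letters, each sliding the short arc by one place. *)
Lemma short_arc_block N D f d : N < n -> d <= N -> straight N D ->
  (forall q, q < N + N -> letter D (rank N q) = f q) ->
  short_arc N (D * block g N.+1 (N.+1 - d)) (N + d) f false.
Proof.
move=> Nn dN sD hf; elim: d dN => [|d IH] dN.
  by rewrite subn0 addn0 block_nil // mulg1; apply: short_arc_straight.
have iN : N - d < n by lia.
rewrite -(@block_cat _ g N.+1 (N.+1 - d)); last lia.
have -> : block g (N.+1 - d) (N.+1 - d.+1) = TL_gen (Ordinal iN).
  rewrite -gE (_ : N.+1 - d = (N.+1 - d.+1).+1) ?block1 /=; last lia.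
  by congr g; lia.
rewrite mulgA; apply: short_arc_slide => //=; [by apply: IH; lia|lia].
Qed.

Lemma normal_form_letter N X f : N <= n -> normal_form g N X f ->
  straight N X /\ forall q, q < N + N -> letter X (rank N q) = f q.
Proof.
move=> Nn nf;
  elim: nf Nn => {N X f} [f _|N X f p f' _ IH hp _ hf' Nn|N X f f' _ IH hf' Nn].
- split=> // p _ pn; rewrite addn0 in pn.
  by split; [apply: partner_one|apply: blob_one].
- have [sX hX] := IH (ltnW Nn).
  have [] := @short_arc_block N X f (p - N) Nn ltac:(lia) sX hX.
  rewrite (_ : N.+1 - (p - N) = (N + N).+1 - p); last lia.
  rewrite subnKC; last lia.
  by move=> s _ h; split=> // q qN; rewrite hf' -?h //; lia.
- have [sX hX] := IH (ltnW Nn).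
  (* All letters but the one of index 0 bring the arc to the end of the word, where it receives its
     blob. *)
  have := @short_arc_block N X f N Nn ltac:(lia) sX hX.
  rewrite subSnn => sb; have i0 : 0 < n by lia.
  have [s _ h] := @short_arc_blob N _ f (Ordinal i0) Nn (erefl _) sb.
  have -> : X * block g N.+1 0 = X * block g N.+1 1 * TL_gen (Ordinal i0).
    by rewrite -mulgA -gE -(@block1 _ g) block_cat.
  by split=> // q qN; rewrite hf' -?h //; lia.
Qed.

End NormalFormLetters.

(** This bounds the position of an insertion from below: the last inserted arc opens at [N.-1] or
    later, so a final run of closing letters cannot start earlier than [N]. *)
Lemma normal_form_half (M : monoidType) (g : nat -> M) N x f p :
  normal_form g N x f -> (forall q, p <= q < N + N -> (f q).1 = false) -> N <= p.
Proof.
case=> // {}N {}x {}f => [p' f' _ hp _ hf|f' _ hf] hc.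
  case: (leqP p p') => pp; last lia.
  by have := hc p' ltac:(lia); rewrite hf; [rewrite /insert_arc ltnn eqxx|lia].
case: (leqP p (N + N)) => pp; last lia.
by have := hc (N + N) ltac:(lia); rewrite hf; [rewrite /insert_arc ltnn eqxx|lia].
Qed.

(* The last opening endpoint is adjacent to the other end of its arc. *)
Lemma normal_form_exists (M : monoidType) (g : nat -> M) D N (a : nat -> nat) :
  (forall i j, i < j < N + N -> a i < a j) ->
  (forall i, i < N + N -> a i < n + n) ->
  (forall i, i < N + N -> exists2 j, j < N + N & partner D (a i) = a j) ->
  exists x, normal_form g N x (fun q => letter D (a q)).
Proof.
elim: N a => [|N IH] a; first by exists 1; apply: normal_one.
rewrite addSn addnS => amono an aarc.
have aN i j : i < (N + N).+2 -> j < (N + N).+2 -> (a i < a j) = (i < j).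
  move=> iN jN; case: (ltngtP i j) => ij; first by rewrite amono ?ij.
    by apply/negbTE; rewrite -leqNgt ltnW // amono ?ij.
  by rewrite ij ltnn.
have [p [pN po pmax]] : exists p, [/\ p < (N + N).+2, a p < partner D (a p) &
    forall q, p < q < (N + N).+2 -> (a q < partner D (a q)) = false].
  have ex : exists p, (p < (N + N).+2) && (a p < partner D (a p)).
    exists 0; have [[|j] jN e] := aarc 0 isT; last by rewrite e aN.
    by have := partner_neq D (an 0 isT); rewrite e eqxx.
  have bd p : (p < (N + N).+2) && (a p < partner D (a p)) -> p <= (N + N).+1.
    by case/andP.
  case: (ex_maxnP ex bd) => p /andP[pN po] pmax; exists p; split=> // q /andP[pq qN].
  by apply/negbTE/negP => qo; have := pmax q; rewrite qN qo leqNgt pq => /(_ isT).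
have closer q : p < q < (N + N).+2 -> exists2 t, t <= p & partner D (a q) = a t.
  move=> /andP[pq qN]; have [t tN e] := aarc q qN; exists t => //.
  rewrite leqNgt; apply/negP => pt.
  have := pmax t; rewrite pt tN -e partnerK ?an // => /(_ isT).
  have := pmax q; rewrite pq qN => /(_ isT).
  by have := partner_neq D (an q qN); case: ltngtP.
have ainj i j : i < (N + N).+2 -> j < (N + N).+2 -> a i = a j -> i = j.
  by move=> iN jN e; have := aN i j iN jN; have := aN j i jN iN; rewrite e ltnn;
    case: ltngtP.
have ap : p < (N + N).+1 /\ partner D (a p) = a p.+1.
  have [r rN e] := aarc p pN; have pr : p < r by rewrite -aN // -e.
  split; first lia.
  have [rp|ne] := eqVneq r p.+1; first by rewrite e rp.
  (* Otherwise [p.+1] closes an arc opened at some [t < p], which crosses the arc from [p] to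
     [r]. *)
  have [t tp e'] := closer p.+1 ltac:(lia).
  have pN' : p.+1 < (N + N).+2 by lia.
  have [tp'|tp'] := eqVneq t p.
    have := partnerK D (an _ pN'); rewrite e' tp' e => /ainj; lia.
  have et : partner D (a t) = a p.+1 by rewrite -e' partnerK ?an.
  have lt : t < p by lia.
  by case: (@partner_nc _ D (a t) (a p)); rewrite ?et ?e ?aN ?an //; lia.
case: ap => pN1 ap; have pN2 : p.+1 < (N + N).+2 by lia.
have ap1 : partner D (a p.+1) = a p by rewrite -ap partnerK // an.
(* [b] lists the endpoints left after removal of the short arc. *)
pose b i := if i < p then a i else a i.+2.
have [||| y nf] := IH b.
- move=> i j ij; rewrite /b; do 2!case: ifP => ?; apply: amono; lia.
- by move=> i iN; rewrite /b; case: ifP => ?; apply: an; lia.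
- move=> i iN; pose i' := if i < p then i else i.+2.
  have bi : b i = a i' by rewrite /b /i'; case: ifP.
  have iN' : i' < (N + N).+2 by rewrite /i'; case: ifP; lia.
  have ip : i' != p by rewrite /i'; case: ifP; lia.
  have ip1 : i' != p.+1 by rewrite /i'; case: ifP; lia.
  have [j jN e] := aarc i' iN'; rewrite bi e.
  have ej : partner D (a j) = a i' by rewrite -e partnerK ?an.
  have jp : j != p.
    by apply: contraNneq ip1 => jp; apply/eqP/ainj => //; rewrite -ej jp.
  have jp1 : j != p.+1.
    by apply: contraNneq ip => jp'; apply/eqP/ainj => //; rewrite -ej jp'.
  exists (if j < p then j else j.-2); first by case: ifP; lia.
  rewrite /b; case: (ltnP j p) => jp'; first by rewrite jp'.
  by rewrite ifF; [congr a|]; lia.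
have cl q : p <= q < N + N -> (letter D (b q)).1 = false.
  by move=> hq; rewrite /letter /b ifF /=; [apply: pmax; lia|lia].
have hp : N <= p := normal_form_half nf cl.
have ins q : q < (N + N).+2 -> letter D (a q) =
    insert_arc p (blob_at D (a p)) (fun q => letter D (b q)) q.
  move=> qN; rewrite /insert_arc /b; case: ltngtP => qp //.
  - case: eqP => [->|ne].
      by rewrite /letter ap1 ltnNge (ltnW (amono _ _ _)) ?ltnSn //= -ap blob_partner ?an.
    by rewrite ifF; [congr (letter D (a _))|]; lia.
  - by rewrite qp /letter po.
case bp: (blob_at D (a p)) ins => ins; last first.
  eexists; apply: normal_cup nf _ cl ins; lia.
(* A blobbed short arc is at the end: otherwise [p.+2] closes an arc opened before [p], which hides
   the blob from the left side. *)
suff pE : p = N + N by rewrite pE in ins; eexists; apply: normal_blob nf ins.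
have [lt|] := ltnP p.+2 (N + N).+2; last lia.
have [t tp e] := closer p.+2 ltac:(lia).
have tN : t < (N + N).+2 by lia.
have et : partner D (a t) = a p.+2 by rewrite -e partnerK ?an.
have tp' : t != p by apply/eqP => e'; move: et; rewrite e' ap => /ainj; lia.
by case: (@blob_exposed _ D (a p) (a t)); rewrite ?an ?et ?aN //; lia.
Qed.

End Letters.

(** * Words in generators *)

Section WordProduct.
Variables (A : Type) (M : monoidType) (g : A -> M).

Definition word_prod (w : seq A) : M := foldr (fun a x => g a * x) 1 w.

Lemma word_prod_cat v w : word_prod (v ++ w) = word_prod v * word_prod w.
Proof. by elim: v => [|a v IH] /=; rewrite ?mul1g // IH mulgA. Qed.

Lemma word_prod1 a : word_prod [:: a] = g a.
Proof. exact: mulg1. Qed.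

Lemma word_prod2 a b : word_prod [:: a; b] = g a * g b.
Proof. by rewrite /= mulg1. Qed.

Lemma word_prod3 a b c : word_prod [:: a; b; c] = g a * g b * g c.
Proof. by rewrite /= mulg1 mulgA. Qed.

End WordProduct.

Section UniversalProperty.
Variables (A : choiceType) (R : seq A -> seq A -> Prop).
Notation P := (presented_monoid R).

Lemma pres_pi_catE (v w : seq A) : \pi_P%qT (v ++ w) = \pi_P%qT v * \pi_P%qT w.
Proof. exact: pres_pi_cat. Qed.

Lemma pres_pi_word w : \pi_P%qT w = word_prod (@pres_gen A R) w.
Proof. by elim: w => //= a w <-; rewrite -(pres_pi_catE [:: a]). Qed.

Lemma pres_gen_rel v w : R v w ->
  word_prod (@pres_gen A R) v = word_prod (@pres_gen A R) w.
Proof.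
move=> vw; rewrite -!pres_pi_word; apply/pres_piP.
by have := pres_step [::] [::] vw; rewrite !cats0.
Qed.

Variables (M : monoidType) (g : A -> M).
Notation word_prod := (word_prod g).

(** The value is computed on a chosen representative; [pres_lift_pi] shows that the choice is
    immaterial when [g] respects [R]. *)
Definition pres_lift (x : P) : M := word_prod (repr x).

Hypothesis gR : forall v w, R v w -> word_prod v = word_prod w.

Lemma pres_lift_pi w : pres_lift (\pi_P%qT w) = word_prod w.
Proof.
have word_eq x y : pres_eq R x y -> word_prod x = word_prod y.
  elim=> // [{}x {}y z _ -> _ ->|p q {}x {}y /gR xy] //.
  by rewrite !word_prod_cat xy.
by apply: word_eq; apply/pres_piP; rewrite reprK.
Qed.

Lemma pres_liftM : {morph pres_lift : x y / x * y}.
Proof.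
move=> x y; rewrite -[x]reprK -[y]reprK -pres_pi_catE !pres_lift_pi.
exact: word_prod_cat.
Qed.

Lemma pres_lift1 : pres_lift 1 = 1.
Proof. exact: (pres_lift_pi [::]). Qed.

Lemma pres_lift_gen a : pres_lift (pres_gen R a) = g a.
Proof. by rewrite pres_lift_pi word_prod1. Qed.

End UniversalProperty.

(** * The isomorphism *)

Section Isomorphism.
Variable n : nat.

Lemma TL_gen_rel v w : blob_rel v w -> word_prod (@TL_gen n) v = word_prod (@TL_gen n) w.
Proof.
case=> [i|i j ij|i j i0 j1|i j ij i0 j0]; rewrite ?word_prod3 ?word_prod2 ?word_prod1.
- exact: TL_gen_idem.
- by case/orP: ij => ij; [|symmetry]; apply: TL_gen_comm.
- exact: TL_gen_101.
- exact: TL_gen_braid.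
Qed.

Definition blob_to_TL : blob_monoid n -> blobbed_TL n := pres_lift (@TL_gen n).

Lemma blob_to_TLM : {morph blob_to_TL : x y / x * y}.
Proof. exact: pres_liftM TL_gen_rel. Qed.

Lemma blob_to_TL1 : blob_to_TL 1 = 1.
Proof. exact: pres_lift1 TL_gen_rel. Qed.

Lemma blob_to_TL_gen i : blob_to_TL (blob_gen i) = TL_gen i.
Proof. exact: pres_lift_gen TL_gen_rel i. Qed.

(** Blocks take generators indexed by natural numbers; indices from [n] on get the default [1]. *)
Let g (i : nat) : blob_monoid n := if insub i is Some j then blob_gen j else 1.
Let gT (i : nat) : blobbed_TL n := if insub i is Some j then TL_gen j else 1.

Let gE (i : 'I_n) : g i = blob_gen i.
Proof. by rewrite /g valK. Qed.

Let gTE (i : 'I_n) : gT i = TL_gen i.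
Proof. by rewrite /gT valK. Qed.

Let gW i (iN : i < n) : g i = pres_gen (@blob_rel n) (Ordinal iN).
Proof. exact: gE (Ordinal iN). Qed.

Lemma blob_normal_form (x : blob_monoid n) : exists f, normal_form g n x f.
Proof.
apply: (@generated_normal_form _ g n) => //.
- move=> i iN; have := pres_gen_rel (blob_idem (Ordinal iN)).
  by rewrite word_prod2 word_prod1 -gW.
- move=> i j ij jN; have iN : i < n by lia.
  have := pres_gen_rel (@blob_comm n (Ordinal iN) (Ordinal jN) _).
  by rewrite !word_prod2 -!gW; apply; rewrite ij.
- move=> n1;
  have := pres_gen_rel (@blob_101 n (Ordinal (ltnW n1)) (Ordinal n1) (erefl _) (erefl _)).
  by rewrite word_prod3 word_prod1 -!gW.
- move=> i iN; have h := pres_gen_rel (@blob_tl n _ _ _ _ _).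
  have := (h (Ordinal (ltnW iN)) (Ordinal iN), h (Ordinal iN) (Ordinal (ltnW iN))).
  rewrite !word_prod3 !word_prod1 -!gW /= eqxx orbT => -[h1 h2].
  by split; [apply: h1|apply: h2].
rewrite -[x]reprK pres_pi_word; elim: (repr x) => [|i w IH]; first exact: generated_one.
by rewrite /= -[pres_gen _ _]gE; apply: generated_mul.
Qed.

Lemma blob_to_TL_block a k : blob_to_TL (block g a k) = block gT a k.
Proof.
elim: a => [|a IH] /=; first exact: blob_to_TL1.
case: ifP => _; last exact: blob_to_TL1.
rewrite blob_to_TLM IH /g /gT; case: insubP => [i _ _|_].
  by rewrite blob_to_TL_gen.
by rewrite blob_to_TL1.
Qed.

Lemma blob_to_TL_normal_form N x f :
  normal_form g N x f -> normal_form gT N (blob_to_TL x) f.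
Proof.
elim=> {N x f} [f|N x f p f' _ IH hp hf hf'|N x f f' _ IH hf'].
- rewrite blob_to_TL1; exact: normal_one.
- by rewrite blob_to_TLM blob_to_TL_block; apply: normal_cup IH _ _ hf'.
- by rewrite blob_to_TLM blob_to_TL_block; apply: normal_blob IH hf'.
Qed.

Lemma blob_normal_form_letter x f p :
  normal_form g n x f -> p < n + n -> letter (blob_to_TL x) p = f p.
Proof.
move=> /blob_to_TL_normal_form/(normal_form_letter gTE (leqnn n))[_ h] pn.
(* With all [n] strands counted, [rank] is the identity. *)
by rewrite -h // /rank; case: ifP => // _; congr letter; lia.
Qed.

(** The diagram determines the word of any normal form, and the word determines the element. *)
Lemma blob_to_TL_inj : injective (blob_to_TL).
Proof.
move=> x y xy; have [[f nx] [f' ny]] := (blob_normal_form x, blob_normal_form y).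
apply: normal_form_inj (nx) (ny) _ => p pn.
by rewrite -(blob_normal_form_letter nx) // xy (blob_normal_form_letter ny).
Qed.

Lemma blob_to_TL_surj D : exists x, blob_to_TL x = D.
Proof.
(* All [n + n] ranks are listed, by the identity. *)
have [||| x nx] := @normal_form_exists n _ g D n id.
- by move=> i j /andP[].
- by [].
- by move=> i iN; exists (partner D i); rewrite ?partner_lt.
by exists x; apply: letter_inj => p pn; apply: blob_normal_form_letter nx pn.
Qed.

End Isomorphism.

Unset Implicit Arguments.

Theorem theorem2p11 (n : nat) (hn : (1 <= n)%N) :
  exists phi : blob_monoid n -> blobbed_TL n,
    [/\ monoid_morphism phi,
        bijective phi
      & forall i : 'I_n, phi (blob_gen i) = TL_gen i].
Proof.
exists (@blob_to_TL n); split; last exact: blob_to_TL_gen.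
- by split; [apply: blob_to_TL1|apply: blob_to_TLM].
(* The boolean equation allows [xchoose] to select a preimage. *)
have h (D : blobbed_TL n) : exists x, blob_to_TL x == D.
  by have [x xD] := blob_to_TL_surj D; exists x; apply/eqP.
exists (fun D => xchoose (h D)) => [x|D]; last exact/eqP/(xchooseP (h D)).
by apply: blob_to_TL_inj; apply/eqP/(xchooseP (h _)).
Qed.
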